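(* Let $\mathcal{C}\in\{\text{proper},\text{s-proper},\text{compact}\}$. The notions of $\mathcal{C}$-type and of strong $\mathcal{C}$-type are invariant under gauge equivalences of Dirac structures: if $(M,L)$ is a Dirac manifold and $\alpha\in\Omega^2(M)$ is a closed 2-form, then $(M,L)$ is of $\mathcal{C}$-type (respectively, strong $\mathcal{C}$-type) if and only if $(M,\alpha\cdot L)$ is of $\mathcal{C}$-type (respectively, strong $\mathcal{C}$-type).
   Context: A Dirac structure on $M$ is a subbundle $L\subset TM\oplus T^*M$ that is maximally isotropic for $\langle X+\alpha,Y+\beta\rangle_+=\frac12(\beta(X)+\alpha(Y))$ and whose sections are closed under the bracket $[X+\alpha,Y+\beta]=[X,Y]+\mathcal{L}_X\beta-\mathcal{L}_Y\alpha-\frac12 d(i_X\beta-i_Y\alpha)$. Then $L$ is a Lie algebroid with anchor the projection to $TM$. For a closed 2-form $\alpha$, the gauge transform of $L$ is $\alpha\cdot L=\{(X,\beta+i_X\alpha):(X,\beta)\in L\}$, again a Dirac structure; two Dirac structures are gauge equivalent if they are related in this way. A presymplectic groupoid $(\mathcal{G},\Omega)\rightrightarrows M$ is a Hausdorff Lie groupoid (source $s$, target $t$) with $\dim\mathcal{G}=2\dim M$ and a closed multiplicative 2-form $\Omega$ (i.e. $m^*\Omega=\mathrm{pr}_1^*\Omega+\mathrm{pr}_2^*\Omega$) such that $\ker\Omega\cap\ker ds\cap\ker dt=\{0\}$; it integrates $(M,L)$ if $t:(\mathcal{G},\Omega)\to(M,L)$ is a forward Dirac map, i.e. $L$ is the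 push-forward by $t$ of the Dirac structure of $\Omega$. $(M,L)$ is integrable if the Lie algebroid $L$ is integrable; its canonical integration $\Sigma(M,L)$ is then the unique (up to isomorphism) presymplectic groupoid integrating it with connected and simply connected $s$-fibers. A Lie groupoid is proper if $(s,t):\mathcal{G}\to M\times M$ is a proper map, s-proper if $s$ is proper, compact if its space of arrows is compact, and s-connected if its $s$-fibers are connected. $(M,L)$ is of $\mathcal{C}$-type if it has an s-connected presymplectic groupoid integrating it with property $\mathcal{C}$, and of strong $\mathcal{C}$-type if $\Sigma(M,L)$ is smooth, Hausdorff and has property $\mathcal{C}$. *)

(* Defs.v *)
From HB Require Import structures.
From mathcomp Require Import all_boot all_order all_algebra.
From mathcomp Require Import all_classical all_reals all_analysis.
From mathcomp Require Import ring.

Set Implicit Arguments.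
Unset Strict Implicit.
Unset Printing Implicit Defensive.

Import Order.TTheory GRing.Theory Num.Theory.
Import numFieldNormedType.Exports.

Local Open Scope classical_set_scope.
Local Open Scope ring_scope.

(* Manifolds are presented by their sheaf of smooth functions (functional
   structures; see e.g. G. Bredon, Topology and Geometry, Chapter II): a
   manifold is a Hausdorff, second countable space with a notion of smooth
   function that is locally isomorphic to (R^n, C^oo).  Tangent vectors are
   derivations of germs of smooth functions; vector fields, forms, brackets and
   the exterior derivative are given by their usual invariant formulas.        *)

Section SmoothSpaces.
Context {R : realType}.

Definition partials n (f : 'rV[R]_n -> R^o) (s : seq 'I_n) : 'rV[R]_n -> R^o :=
  foldr (fun i (g : 'rV[R]_n -> R^o) => fun x => 'D_(delta_mx 0 i) g x) f s.

(* Infinite differentiability on a neighbourhood of x: all iterated partial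
   derivatives exist and are (Frechet) differentiable there.                   *)
Definition Cinfty_at n (x : 'rV[R]_n) (f : 'rV[R]_n -> R^o) : Prop :=
  \forall y \near x, forall s : seq 'I_n, differentiable (partials f s) y.

End SmoothSpaces.

(* [smooth_at p f] means that f is smooth on some neighbourhood of p, so the
   smooth functions on an open set U are the f with [smooth_at p f] for all p
   in U.  The usual axioms of a sheaf of algebras of continuous functions are
   not imposed here: on manifolds they follow from [is_manifold].              *)
Record smoothSpace (R : realType) := SmoothSpace {
  carrier :> topologicalType;
  smooth_at : carrier -> (carrier -> R^o) -> Prop }.

Section Manifolds.
Context {R : realType}.
Implicit Types X Y : smoothSpace R.

Definition is_manifold (n : nat) X : Prop :=
  [/\ hausdorff_space X,
      @second_countable X &
      forall p : X, exists (U : set X) (V : set 'rV[R]_n)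
          (phi : X -> 'rV[R]_n) (psi : 'rV[R]_n -> X),
        [/\ [/\ open U, U p & open V],
            [/\ forall q, U q -> V (phi q) /\ psi (phi q) = q
              & forall y, V y -> U (psi y) /\ phi (psi y) = y],
            [/\ forall q, U q -> {for q, continuous phi}
              & forall y, V y -> {for y, continuous psi}] &
            forall q f, U q ->
              smooth_at q f <-> Cinfty_at (phi q) (fun y => f (psi y))]].

(* Continuity is automatic when Y is a manifold: indicator functions of
   neighbourhoods of [f p] are smooth at [f p].                                *)
Definition smooth_map_at X Y (f : X -> Y) (p : X) : Prop :=
  forall h : Y -> R^o, smooth_at (f p) h -> smooth_at p (fun x => h (f x)).

Definition smooth_map X Y (f : X -> Y) : Prop := forall p, smooth_map_at f p.

(* The product smooth structure: smooth functions are locally smooth functions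
   of finitely many smooth functions on the factors (on a product of manifolds,
   of the coordinates).                                                        *)
Definition prod_space X Y : smoothSpace R :=
  @SmoothSpace R (X * Y)%type (fun p f =>
    exists (k l : nat) (a : 'I_k -> X -> R^o) (b : 'I_l -> Y -> R^o)
           (F : 'rV[R]_(k + l) -> R^o),
      let ab (q : X * Y) := row_mx (\row_i a i q.1) (\row_j b j q.2) in
      [/\ forall i, smooth_at p.1 (a i),
          forall j, smooth_at p.2 (b j),
          Cinfty_at (ab p) F &
          \forall q \near p, f q = F (ab q)]).

(* The smooth structure induced on a subset: smooth functions are locally
   restrictions of smooth functions.  A subset is an embedded submanifold iff
   this induced structure makes it a manifold.                                 *)
Definition sub_space X (A : set X) : smoothSpace R :=
  @SmoothSpace R (set_type A) (fun p f =>
    exists F : X -> R^o, smooth_at (set_val p) F /\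
      \forall q \near p, f q = F (set_val q)).

(* Derivations at p of the germs of smooth functions.  The value of v on
   functions that are not smooth at p is normalized to 0, so that tangent
   vectors are equal iff they agree on smooth functions.                       *)
Definition derivation X (p : X) : {pred ((X -> R^o) -> R^o)} := fun v =>
  `[< [/\ forall (a : R) f g, smooth_at p f -> smooth_at p g ->
            v (fun x => a * f x + g x) = a * v f + v g,
          forall f g, smooth_at p f -> smooth_at p g ->
            v (fun x => f x * g x) = v f * g p + f p * v g &
          forall f, ~ smooth_at p f -> v f = 0] >].

Fact derivation_submod X (p : X) : submod_closed (derivation p).
Proof.
split=> [|c u v /asboolP[ul um u0] /asboolP[vl vm v0]]; apply/asboolP.
  have E f : (0 : (X -> R^o) -> R^o) f = 0 by [].
  by split=> *; rewrite !E ?mulr0 ?mul0r ?addr0.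
have E f : (c *: u + v) f = c * u f + v f :> R by [].
split=> [a f g sf sg|f g sf sg|f sf]; rewrite !E.
- by rewrite ul// vl//; ring.
- by rewrite um// vm//; ring.
- by rewrite u0// v0// mulr0 addr0.
Qed.

HB.instance Definition _ X (p : X) :=
  GRing.isSubmodClosed.Build R ((X -> R^o) -> R^o) (derivation p)
    (derivation_submod p).

Record tangent X (p : X) := Tangent {
  tangent_fun :> (X -> R^o) -> R^o;
  _ : tangent_fun \in derivation p }.

HB.instance Definition _ X (p : X) := [isSub for @tangent_fun X p].
HB.instance Definition _ X (p : X) := [Choice of tangent p by <:].
HB.instance Definition _ X (p : X) :=
  [SubChoice_isSubLmodule of tangent p by <:].

End Manifolds.

Section TangentCalculus.
Context {R : realType}.
Implicit Types X Y : smoothSpace R.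

(* [dmap f v] is the differential of f applied to v.  The default value 0 of
   [insubd] is irrelevant: when f is a map of manifolds that is smooth at p, the
   pushed forward functional is a derivation.  The same applies to
   [lie_bracket], for vector fields that are smooth at p.                      *)
Definition dmap X Y (f : X -> Y) (p : X) (v : tangent p) : tangent (f p) :=
  insubd (0 : tangent (f p))
    (fun h : Y -> R^o => if `[< smooth_at (f p) h >] then v (fun x => h (f x))
                         else 0).

Definition submersion X Y (f : X -> Y) : Prop :=
  smooth_map f /\
  forall p (w : tangent (f p)), exists v : tangent p, dmap f v = w.

Definition covector X (p : X) := tangent p -> R^o.
Definition vector_field X := forall p : X, tangent p.
Definition one_form X := forall p : X, covector p.
Definition two_form X := forall p : X, tangent p -> covector p.

Definition smooth_vf_at X (p : X) (V : vector_field X) : Prop :=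
  forall f, smooth_at p f -> smooth_at p (fun q => V q f).

Definition smooth_one_form_at X (p : X) (b : one_form X) : Prop :=
  forall V, smooth_vf_at p V -> smooth_at p (fun q => b q (V q)).

Definition lie_bracket X (V W : vector_field X) : vector_field X := fun p =>
  insubd (0 : tangent p)
    (fun f : X -> R^o =>
       if `[< smooth_at p f >] then V p (fun q => W q f) - W p (fun q => V q f)
       else 0).

Definition contract X (V : vector_field X) (b : one_form X) : X -> R^o :=
  fun q => b q (V q).

Definition extension X (p : X) (v : tangent p) : vector_field X :=
  xget (fun q => 0 : tangent q)
    [set V : forall q, tangent q | smooth_vf_at p V /\ V p = v].

(* (L_V b)(W) = V (b(W)) - b([V, W]); at p this only depends on W p *)
Definition lie_derivative X (V : vector_field X) (b : one_form X) : one_form X :=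
  fun p v =>
    let W := extension v in
    V p (contract W b) - b p (lie_bracket V W p).

Definition is_two_form X (w : two_form X) : Prop :=
  [/\ forall p u, linear (w p u : tangent p -> R^o),
      forall p u, w p u u = 0,
      forall p u v, w p u v = - w p v u &
      forall p U V, smooth_vf_at p U -> smooth_vf_at p V ->
        smooth_at p (fun q => w q (U q) (V q))].

Definition ext_d2 X (w : two_form X) (U V W : vector_field X) : X -> R^o :=
  fun p => U p (fun q => w q (V q) (W q))
         - V p (fun q => w q (U q) (W q))
         + W p (fun q => w q (U q) (V q))
         - w p (lie_bracket U V p) (W p)
         + w p (lie_bracket U W p) (V p)
         - w p (lie_bracket V W p) (U p).

(* Vector fields are only required to be smooth near p; on a manifold this is
   the same as testing on global vector fields.                                *)
Definition closed_two_form X (w : two_form X) : Prop :=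
  is_two_form w /\
  forall p U V W, smooth_vf_at p U -> smooth_vf_at p V -> smooth_vf_at p W ->
    ext_d2 w U V W p = 0.

Definition pullback X Y (f : X -> Y) (w : two_form Y) : two_form X :=
  fun p u v => w (f p) (dmap f u) (dmap f v).

End TangentCalculus.

Section DiracStructures.
Context {R : realType}.
Implicit Types M : smoothSpace R.

(* Elements of the fibre of TM (+) T^*M at p are pairs (X, b) with b linear;
   linearity is part of [subspace_TT].                                         *)
Definition fiberTT M (p : M) := (tangent p * (tangent p -> R^o))%type.
Definition sectionTT M := forall p : M, fiberTT p.
Definition subfamilyTT M := forall p : M, set (fiberTT p).

Definition pairing M (p : M) (e1 e2 : fiberTT p) : R :=
  2^-1 * (e2.2 e1.1 + e1.2 e2.1).

Definition subspace_TT M (p : M) (A : set (fiberTT p)) : Prop :=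
  [/\ forall e, A e -> linear e.2, A 0 &
      forall (a : R) e1 e2, A e1 -> A e2 -> A (a *: e1 + e2)].

Definition isotropic M (p : M) (A : set (fiberTT p)) : Prop :=
  forall e1 e2, A e1 -> A e2 -> pairing e1 e2 = 0.

Definition maximally_isotropic M (p : M) (A : set (fiberTT p)) : Prop :=
  [/\ subspace_TT A, isotropic A &
      forall B : set (fiberTT p),
        subspace_TT B -> isotropic B -> A `<=` B -> B = A].

Definition smooth_section_at M (p : M) (e : sectionTT M) : Prop :=
  smooth_vf_at p (fun q => (e q).1) /\ smooth_one_form_at p (fun q => (e q).2).

Definition smooth_subbundle M (L : subfamilyTT M) : Prop :=
  forall p : M, exists (r : nat) (e : 'I_r -> sectionTT M),
    (forall i, smooth_section_at p (e i)) /\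
    \forall q \near p,
      [/\ forall i, L q (e i q),
          forall x, L q x -> exists c : 'I_r -> R, x = \sum_i c i *: e i q &
          forall c : 'I_r -> R, \sum_i c i *: e i q = 0 -> forall i, c i = 0].

(* [X + a, Y + b] = [X, Y] + L_X b - L_Y a - 1/2 d(i_X b - i_Y a) *)
Definition courant_bracket M (e1 e2 : sectionTT M) : sectionTT M := fun p =>
  let X q := (e1 q).1 in let a q := (e1 q).2 in
  let Y q := (e2 q).1 in let b q := (e2 q).2 in
  (lie_bracket X Y p,
   fun v : tangent p =>
     lie_derivative X b v - lie_derivative Y a v
     - 2^-1 * v (fun q => contract X b q - contract Y a q)).

(* closure under the bracket of the sections defined near a point; on a manifold
   this is the same as closure of the global sections                          *)
Definition involutive M (L : subfamilyTT M) : Prop :=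
  forall (p : M) (e1 e2 : sectionTT M),
    smooth_section_at p e1 -> smooth_section_at p e2 ->
    (\forall q \near p, L q (e1 q)) -> (\forall q \near p, L q (e2 q)) ->
    L p (courant_bracket e1 e2 p).

Definition is_dirac M (L : subfamilyTT M) : Prop :=
  [/\ smooth_subbundle L,
      forall p, maximally_isotropic (L p) &
      involutive L].

Definition gauge M (alpha : two_form M) (L : subfamilyTT M) : subfamilyTT M :=
  fun p => [set (e.1, e.2 + alpha p e.1) | e in L p].

Definition graph_two_form M (w : two_form M) : subfamilyTT M :=
  fun p => [set e | e.2 = w p e.1].

(* At every p, L (f p) is the push-forward {(df v, b) : (v, f^* b) in D p}.    *)
Definition forward_dirac (X Y : smoothSpace R) (f : X -> Y)
    (D : subfamilyTT X) (L : subfamilyTT Y) : Prop :=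
  forall p : X, L (f p) =
    [set e | linear e.2 /\ exists v : tangent p,
       dmap f v = e.1 /\ D p (v, fun w => e.2 (dmap f w))].

End DiracStructures.

Section Groupoids.
Context {R : realType}.

Definition composable (G M : smoothSpace R) (src tgt : G -> M)
    : smoothSpace R :=
  sub_space (X := prod_space G G) [set gh : G * G | src gh.1 = tgt gh.2].

(* Hausdorff Lie groupoids over M, which is understood to be a manifold of
   dimension m.  The product g h is defined when [src g = tgt h]; [mul_arrow] is
   a total function that is only meaningful on such pairs.  [composableP] holds
   automatically, [src] being a submersion: it records that the composable pairs
   form an embedded submanifold of G x G, on which [mul_arrow] is smooth.      *)
Record lieGroupoid (m : nat) (M : smoothSpace R) := LieGroupoid {
  arrows :> smoothSpace R;
  gdim : nat;
  src : arrows -> M;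
  tgt : arrows -> M;
  unit_arrow : M -> arrows;
  inv_arrow : arrows -> arrows;
  mul_arrow : arrows -> arrows -> arrows;
  arrowsP : is_manifold gdim arrows;
  src_submersion : submersion src;
  tgt_submersion : submersion tgt;
  composableP : is_manifold (gdim + gdim - m)%N (composable src tgt);
  one_smooth : smooth_map unit_arrow;
  inv_smooth : smooth_map inv_arrow;
  mul_smooth : smooth_map (fun gh : composable src tgt =>
                             mul_arrow (set_val gh).1 (set_val gh).2);
  src_one : forall x, src (unit_arrow x) = x;
  tgt_one : forall x, tgt (unit_arrow x) = x;
  src_mul : forall g h, src g = tgt h -> src (mul_arrow g h) = src h;
  tgt_mul : forall g h, src g = tgt h -> tgt (mul_arrow g h) = tgt g;
  mulA : forall g h k, src g = tgt h -> src h = tgt k ->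
    mul_arrow g (mul_arrow h k) = mul_arrow (mul_arrow g h) k;
  mul1g : forall g, mul_arrow (unit_arrow (tgt g)) g = g;
  mulg1 : forall g, mul_arrow g (unit_arrow (src g)) = g;
  src_inv : forall g, src (inv_arrow g) = tgt g;
  tgt_inv : forall g, tgt (inv_arrow g) = src g;
  mulVg : forall g, mul_arrow (inv_arrow g) g = unit_arrow (src g);
  mulgV : forall g, mul_arrow g (inv_arrow g) = unit_arrow (tgt g) }.

Arguments src {m M l}.
Arguments tgt {m M l}.

Section OneGroupoid.
Context {m : nat} {M : smoothSpace R} (G : lieGroupoid m M).

Definition composable_pairs : smoothSpace R := composable (@src _ _ G) tgt.
Definition pr1 (gh : composable_pairs) : G := (set_val gh).1.
Definition pr2 (gh : composable_pairs) : G := (set_val gh).2.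
Definition mul_map (gh : composable_pairs) : G := mul_arrow (pr1 gh) (pr2 gh).

Definition multiplicative (W : two_form G) : Prop :=
  forall (gh : composable_pairs) (u v : tangent gh),
    pullback mul_map W u v = pullback pr1 W u v + pullback pr2 W u v.

Definition src_fiber (x : M) : set G := [set g | src g = x].

Definition s_connected : Prop := forall x, connected (src_fiber x).

Definition proper_map (X Y : topologicalType) (f : X -> Y) : Prop :=
  continuous f /\ forall K : set Y, compact K -> compact (f @^-1` K).

End OneGroupoid.

Arguments src_fiber {m M} G x.

Definition path_connected (X : topologicalType) (A : set X) : Prop :=
  forall x y, A x -> A y -> exists gamma : R -> X,
    [/\ {within `[0, 1], continuous gamma},
        forall r, r \in `[0, 1] -> A (gamma r), gamma 0 = x & gamma 1 = y].

Definition simply_connected (X : topologicalType) (A : set X) : Prop :=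
  path_connected A /\
  forall gamma : R -> X,
    {within `[0, 1], continuous gamma} ->
    (forall r, r \in `[0, 1] -> A (gamma r)) -> gamma 0 = gamma 1 ->
    exists H : R * R -> X,
      [/\ {within `[0, 1] `*` `[0, 1], continuous H},
          forall q r, q \in `[0, 1] -> r \in `[0, 1] -> A (H (q, r)),
          forall r, r \in `[0, 1] -> H (0, r) = gamma r,
          forall r, r \in `[0, 1] -> H (1, r) = gamma 0 &
          forall q, q \in `[0, 1] -> H (q, 0) = gamma 0 /\ H (q, 1) = gamma 0].

Record presymplecticGroupoid (m : nat) (M : smoothSpace R) :=
    PresymplecticGroupoid {
  groupoid :> lieGroupoid m M;
  omega : two_form groupoid;
  groupoid_dim : gdim groupoid = (2 * m)%N;
  omega_closed : closed_two_form omega;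
  omega_mul : multiplicative omega;
  omega_ker : forall (g : groupoid) (v : tangent g),
    (forall w, omega v w = 0) -> dmap src v = 0 -> dmap tgt v = 0 -> v = 0 }.

Definition integrates (m : nat) (M : smoothSpace R)
    (G : presymplecticGroupoid m M) (L : subfamilyTT M) : Prop :=
  forward_dirac (@tgt _ _ G) (graph_two_form (@omega _ _ G)) L.

(* (M, L) is integrable with smooth Hausdorff canonical integration iff there is
   such a G, which is then unique up to isomorphism.                           *)
Definition is_canonical_integration (m : nat) (M : smoothSpace R)
    (G : presymplecticGroupoid m M) (L : subfamilyTT M) : Prop :=
  integrates G L /\
  forall x, connected (src_fiber G x) /\ simply_connected (src_fiber G x).

Inductive compactness := Proper | SProper | Compact.

Definition has_compactness (C : compactness) (m : nat) (M : smoothSpace R)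
    (G : lieGroupoid m M) : Prop :=
  match C with
  | Proper => proper_map (fun g : G => (src g, tgt g))
  | SProper => proper_map (@src _ _ G)
  | Compact => compact [set: G]
  end.

Definition C_type (C : compactness) (m : nat) (M : smoothSpace R)
    (L : subfamilyTT M) : Prop :=
  exists G : presymplecticGroupoid m M,
    [/\ integrates G L, s_connected G & has_compactness C G].

Definition strong_C_type (C : compactness) (m : nat) (M : smoothSpace R)
    (L : subfamilyTT M) : Prop :=
  exists G : presymplecticGroupoid m M,
    is_canonical_integration G L /\ has_compactness C G.

End Groupoids.

(* Main.v *)
Require Import Defs.
From HB Require Import structures.
From mathcomp Require Import all_boot all_order all_algebra.
From mathcomp Require Import all_classical all_reals all_analysis.
From mathcomp Require Import ring zify.

Set Implicit Arguments.
Unset Strict Implicit.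
Unset Printing Implicit Defensive.

Import Order.TTheory GRing.Theory Num.Theory.
Import numFieldNormedType.Exports.

Local Open Scope classical_set_scope.
Local Open Scope ring_scope.

(** The gauge transform is realized on the groupoid itself.  If (G, Omega)
    integrates L, then G with the form
      Omega' = Omega + t^*alpha - s^*alpha
    integrates alpha.L.  The Lie groupoid is unchanged, and s-connectedness,
    simple connectedness of the s-fibres and the three compactness conditions
    only depend on it, so each notion passes from L to alpha.L; the converse
    is the same argument for - alpha, since (- alpha).(alpha.L) = L.

    Omega' is multiplicative because t m = t pr1, s m = s pr2 and
    s pr1 = t pr2, and on ker ds /\ ker dt it agrees with Omega, so that the
    kernel condition persists.  Two points need work.

    1. Omega' is a closed 2-form, that is, pull-backs of closed 2-forms are
       closed ([closed_pullback]).  In terms of local coordinates x_i on M this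
       is the usual computation with f^*alpha = sum_ij (a_ij f) d(x_i f) d(x_j f).
       Tangent vectors are derivations of germs, so coordinates are available
       once it is known that a derivation is determined by its values on the
       x_i ([tangent_comp], [frame_exists]); this is Hadamard's lemma
       ([Hadamard]): f(y) = f(x) + sum_i (y_i - x_i) g_i(y) with g_i smooth.

    2. t is a forward Dirac map for Omega' and alpha.L.  Given (X, b) in L at
       t(g) there is v with dt v = X and Omega(v, .) = b dt; then
       Omega'(v, .) = (b + i_X alpha) dt - i_(ds v) alpha ds, and the last term
       is unwanted.  It disappears if v can be chosen in ker ds
       ([source_representative]).  Indeed v lies in the orthogonal of ker dt,
       and this orthogonal is ker ds + (ker dt /\ ker Omega): the right-hand side
       is contained in it because the fibres of s and t are Omega-orthogonal
       ([fibres_orthogonal]), and both have dimension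
       m + dim (ker dt /\ ker Omega), by dim G = 2m and the kernel condition.
       The component of v along ker ds then has the same image under dt and
       the same contraction with Omega.  The opposite inclusion uses the same
       normalization for Omega'.

    The orthogonality of the fibres is the multiplicativity of Omega applied
    to products of tangent vectors.  It requires that any two vectors u, w with
    ds u = dt w are the components of a vector tangent to the manifold of
    composable pairs ([tangent_composable_onto]); this holds because the pairs
    of components form an injective image of dimension 2 dim G - m inside a
    space of the same dimension. *)

(** * Differentiability of functions of several real variables *)

Section LinComb.
Context {R : realType} {n : nat}.
Implicit Types (c : 'I_n -> R).

Definition lincomb c (h : 'rV[R]_n) : R^o := \sum_i c i * h 0 i.

Fact lincomb_linear c : linear (lincomb c).
Proof.
move=> a u v; rewrite /lincomb scaler_sumr -big_split /=; apply: eq_bigr => i _.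
by rewrite !mxE mulrDr mulrCA.
Qed.

HB.instance Definition _ c :=
  GRing.isLinear.Build R 'rV[R]_n R^o _ (lincomb c) (lincomb_linear c).

Lemma lincomb_continuous c : continuous (lincomb c).
Proof.
move=> x; rewrite /lincomb.
have -> : (fun h : 'rV[R]_n => \sum_i c i * h 0 i : R^o) =
   \sum_i (fun h : 'rV[R]_n => c i * h 0 i : R^o).
  by apply/funext => h; rewrite fct_sumE.
apply: differentiable_continuous; apply: differentiable_sum => i.
by apply: differentiableM; [exact: differentiable_cst|exact: differentiable_coord].
Qed.

Lemma lincomb_delta c i : lincomb c (delta_mx 0 i) = c i.
Proof.
rewrite /lincomb (bigD1 i)//= big1 ?addr0 => [|j ji].
  by rewrite mxE !eqxx mulr1.
by rewrite mxE eqxx (negbTE ji) mulr0.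
Qed.

(** A first order expansion determines the partial derivatives; this is the
    form in which differentiability is established for averages over rays, for
    which no differential is available beforehand. *)
Lemma differentiable_of_approx (f : 'rV[R]_n -> R^o) (x : 'rV[R]_n) c :
  (forall e : R, 0 < e ->
     \forall h \near (0 : 'rV[R]_n), `|f (h + x) - f x - lincomb c h| <= e * `|h|) ->
  differentiable f x /\ forall i, 'D_(delta_mx 0 i) f x = c i.
Proof.
move=> H.
have cl := @lincomb_continuous c.
have E : (f \o shift x : 'rV[R]_n -> R^o) = cst (f x) + lincomb c +o_ (0 : 'rV[R]_n) id.
  apply/eqaddoP => e e0; near do rewrite /= opprD addrA; exact: H.
have dE := diff_unique cl E.
have df : differentiable f x by apply/diff_locallyP; rewrite dE.
by split => // i; rewrite deriveE// dE; exact: lincomb_delta.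
Unshelve. all: by end_near. Qed.

Lemma differentiable_approx (f : 'rV[R]_n -> R^o) (x : 'rV[R]_n) :
  differentiable f x -> forall e : R, 0 < e -> \forall h \near (0 : 'rV[R]_n),
   `|f (h + x) - f x - lincomb (fun i => 'D_(delta_mx 0 i) f x) h| <= e * `|h|.
Proof.
move=> df e e0.
have /eqaddoP /(_ e e0) := diff_locally df.
apply: filterS => h.
have <- : 'd f x h = lincomb (fun i => 'D_(delta_mx 0 i) f x) h.
  rewrite [h in LHS]row_sum_delta linear_sum; apply: eq_bigr => i _.
  by rewrite linearZ /= deriveE// mulrC.
by rewrite -!addrA -opprD.
Qed.

End LinComb.

(** * Infinitely differentiable functions on open sets *)

Section SmoothOn.
Context {R : realType}.

Definition smooth_on n (O : set 'rV[R]_n) (f : 'rV[R]_n -> R^o) : Prop :=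
  forall y, O y -> forall s, differentiable (partials f s) y.

Lemma Cinfty_atP n (x : 'rV[R]_n) f :
  Cinfty_at x f <-> exists e : R, 0 < e /\ smooth_on (ball x e) f.
Proof.
split=> [/nbhs_ballP[e /= e0 H]|[e [e0 H]]]; first by exists e.
by apply/nbhs_ballP; exists e.
Qed.

Lemma smooth_on_diff n (O : set 'rV[R]_n) f :
  smooth_on O f -> forall y, O y -> differentiable f y.
Proof. by move=> sf y /sf /(_ [::]). Qed.

Lemma smooth_on_partial n (O : set 'rV[R]_n) f i :
  smooth_on O f -> smooth_on O ('D_(delta_mx 0 i) f).
Proof.
move=> sf y Oy s; have := sf y Oy (rcons s i).
by rewrite /partials foldr_rcons.
Qed.

Lemma near_eq_differentiable n (f g : 'rV[R]_n -> R^o) (x : 'rV[R]_n) :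
  {near x, f =1 g} -> differentiable f x -> differentiable g x.
Proof.
move=> fg df.
suff /differentiable_of_approx[] : forall e : R, 0 < e ->
  \forall h \near (0 : 'rV[R]_n),
   `|g (h + x) - g x - lincomb (fun i => 'D_(delta_mx 0 i) f x) h| <= e * `|h| by [].
move=> e e0; have := differentiable_approx df e0.
rewrite -(nbhs_singleton fg).
move/nbhs0P: fg; apply: filterS2 => h.
by rewrite addrC => ->.
Qed.

(** Smoothness is the largest property that implies differentiability and is
    inherited by partial derivatives.  Hence closure properties follow by
    exhibiting a class S of functions stable under partial derivatives, without
    any formula for the iterated ones. *)
Lemma smooth_on_coind n (O : set 'rV[R]_n) (S : ('rV[R]_n -> R^o) -> Prop) :
  open O ->
  (forall f, S f -> (forall y, O y -> differentiable f y) /\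
     forall i, exists2 g, S g & {in O, 'D_(delta_mx 0 i) f =1 g}) ->
  forall f, S f -> smooth_on O f.
Proof.
move=> oO HS f Sf.
have nearO y (g h : 'rV[R]_n -> R^o) : O y -> {in O, g =1 h} -> {near y, g =1 h}.
  move=> Oy gh; have := open_nbhs_nbhs (conj oO Oy).
  by apply: filterS => z Oz; apply: gh; rewrite inE.
have step s : exists2 g, S g & {in O, partials f s =1 g}.
  elim: s => [|i s [g Sg fg]] /=; first by exists f.
  have [_ /(_ i)[h Sh gh]] := HS g Sg.
  exists h => // y yO; rewrite -gh//; apply: near_eq_derive.
  by apply: nearO fg; rewrite inE in yO.
move=> y Oy s; have [g Sg fg] := step s.
apply: near_eq_differentiable (proj1 (HS g Sg) y Oy).
by apply: nearO Oy _ => z zO; rewrite fg.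
Qed.

Lemma smooth_on_ext n (O : set 'rV[R]_n) f g :
  open O -> {in O, f =1 g} -> smooth_on O f -> smooth_on O g.
Proof.
move=> oO fg sf.
pose S g := exists2 f, smooth_on O f & {in O, f =1 g}.
apply: (@smooth_on_coind _ _ S) => //; last by exists f.
move=> {f g fg sf} g [f sf fg].
have nr y : O y -> {near y, f =1 g}.
  move=> Oy; have := open_nbhs_nbhs (conj oO Oy).
  by apply: filterS => z Oz; apply: fg; rewrite inE.
split=> [y Oy|i].
  exact: near_eq_differentiable (nr y Oy) (smooth_on_diff sf Oy).
exists ('D_(delta_mx 0 i) f).
  by exists ('D_(delta_mx 0 i) f) => //; exact: smooth_on_partial.
by move=> y yO; symmetry; apply: near_eq_derive; apply: nr; rewrite inE in yO.
Qed.

Lemma smooth_on_sub n (O O' : set 'rV[R]_n) f :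
  O' `<=` O -> smooth_on O f -> smooth_on O' f.
Proof. by move=> OO sf y /OO; exact: sf. Qed.

Lemma smooth_on_cst n (O : set 'rV[R]_n) (c : R) : open O -> smooth_on O (fun=> c).
Proof.
move=> oO.
apply: (@smooth_on_coind _ _ (fun g => exists c, g = fun=> c)) => //; last by exists c.
move=> _ [{}c ->]; split=> [y _|i]; first exact: differentiable_cst.
exists (fun=> 0); first by exists 0.
by move=> y _; rewrite derive_cst.
Qed.

Lemma derive_coord n (y : 'rV[R]_n) i j :
  'D_(delta_mx 0 j) (fun z : 'rV[R]_n => z 0 i : R^o) y = (i == j)%:R.
Proof.
have := @differentiable_of_approx _ _ (fun z : 'rV[R]_n => z 0 i : R^o) y
  (fun j => (i == j)%:R).
case=> [e e0|_ ->//].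
near=> h; rewrite mxE addrK /lincomb (bigD1 i)//= big1 ?eqxx => [|k ki].
  by rewrite addr0 mul1r subrr normr0 mulr_ge0// ltW.
by rewrite eq_sym (negbTE ki) mul0r.
Unshelve. all: by end_near. Qed.

Lemma smooth_on_coord n (O : set 'rV[R]_n) i :
  open O -> smooth_on O (fun y => y 0 i).
Proof.
move=> oO.
pose S g := (exists c, g = fun=> c) \/ g = fun y : 'rV[R]_n => y 0 i.
apply: (@smooth_on_coind _ _ S) => //; last by right.
move=> _ [[c ->]|->]; split=> [y _|j]; first exact: differentiable_cst.
- exists (fun=> 0); first by left; exists 0.
  by move=> y _; rewrite derive_cst.
- exact: differentiable_coord.
- exists (fun=> (delta_mx 0 j : 'rV[R]_n) 0 i).
    by left; eexists.
  by move=> y _; rewrite derive_coord mxE eqxx.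
Qed.

Section Composition.
Variables (n k : nat) (O : set 'rV[R]_n) (O' : set 'rV[R]_k).
Variable phi : 'rV[R]_n -> 'rV[R]_k.

(** The algebra generated by the smooth functions on O and the composites
    F o phi.  By the Leibniz and chain rules it is stable under partial
    derivatives, so it consists of smooth functions; sums, products and
    composites are thus treated at once. *)
Inductive generated : ('rV[R]_n -> R^o) -> Prop :=
| gen_base f : smooth_on O f -> generated f
| gen_comp F : smooth_on O' F -> generated (fun y => F (phi y))
| gen_add f g : generated f -> generated g -> generated (fun y => f y + g y)
| gen_mul f g : generated f -> generated g -> generated (fun y => f y * g y).

Hypotheses (oO : open O) (Ophi : forall y, O y -> O' (phi y)).
Hypothesis sphi : forall j, smooth_on O (fun y => phi y 0 j).

Lemma gen_sum (r : seq 'I_k) (F : 'I_k -> 'rV[R]_n -> R^o) :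
  (forall j, generated (F j)) ->
  generated (fun y => \sum_(j <- r) F j y).
Proof.
move=> gF; elim: r => [|j r IH].
  have -> : (fun y => \sum_(j <- [::]) F j y) = fun=> 0.
    by apply/funext => y; rewrite big_nil.
  exact/gen_base/smooth_on_cst.
have -> : (fun y => \sum_(j <- j :: r) F j y) = (fun y => F j y + \sum_(j <- r) F j y).
  by apply/funext => y; rewrite big_cons.
exact: gen_add.
Qed.

Let diff_phi y : O y -> differentiable phi y.
Proof.
move=> Oy.
have -> : phi = \sum_(j < k) (fun y => phi y 0 j *: (delta_mx 0 j : 'rV[R]_k)).
  by apply/funext => z; rewrite fct_sumE [LHS]row_sum_delta.
apply: differentiable_sum => j; apply: differentiableZl.
exact: smooth_on_diff (sphi j) _ Oy.
Qed.

Lemma chain_rule (F : 'rV[R]_k -> R^o) y i : O y -> differentiable F (phi y) ->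
  'D_(delta_mx 0 i) (F \o phi) y =
  \sum_j 'D_(delta_mx 0 j) F (phi y) *
         'D_(delta_mx 0 i) (fun y => phi y 0 j : R^o) y.
Proof.
move=> Oy dF; have dp := diff_phi Oy.
rewrite deriveE; last exact: differentiable_comp.
rewrite diff_comp//=.
rewrite [X in 'd F _ X]row_sum_delta linear_sum; apply: eq_bigr => j _.
rewrite linearZ /= deriveE// [RHS]mulrC; congr (_ * _).
rewrite -deriveE// derive_mx; last exact: diff_derivable.
by rewrite mxE.
Qed.

Lemma smooth_generated f : generated f -> smooth_on O f.
Proof.
move: f; apply: smooth_on_coind => // f; elim=> {f}.
- move=> f sf; split=> [y /(smooth_on_diff sf)//|i].
  by exists ('D_(delta_mx 0 i) f) => //; apply/gen_base/smooth_on_partial.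
- move=> F sF; split=> [y Oy|i].
    by apply: differentiable_comp (diff_phi Oy) (smooth_on_diff sF (Ophi Oy)).
  exists (fun y => \sum_j 'D_(delta_mx 0 j) F (phi y) *
                   'D_(delta_mx 0 i) (fun y => phi y 0 j : R^o) y).
    apply: gen_sum => j; apply: gen_mul.
      by apply: (@gen_comp ('D_(delta_mx 0 j) F)); exact: smooth_on_partial.
    exact/gen_base/smooth_on_partial.
  move=> y; rewrite inE => Oy; apply: chain_rule => //.
  exact: smooth_on_diff (Ophi Oy).
- move=> f g gf [df Df] gg [dg Dg]; split=> [y Oy|i].
    by apply: differentiableD; [exact: df|exact: dg].
  have [f' gf' ff'] := Df i; have [g' gg' gg''] := Dg i.
  exists (fun y => f' y + g' y); first exact: gen_add.
  move=> y yO; rewrite -ff'// -gg''//; rewrite inE in yO.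
  by rewrite -deriveD//; apply: diff_derivable; [exact: df|exact: dg].
- move=> f g gf [df Df] gg [dg Dg]; split=> [y Oy|i].
    by apply: differentiableM; [exact: df|exact: dg].
  have [f' gf' ff'] := Df i; have [g' gg' gg''] := Dg i.
  exists (fun y => f y * g' y + g y * f' y); first by apply: gen_add; exact: gen_mul.
  move=> y yO; rewrite -ff'// -gg''//; rewrite inE in yO.
  by rewrite deriveM//; apply: diff_derivable; [exact: df|exact: dg].
Qed.

End Composition.

Lemma smooth_on_comp n k (O : set 'rV[R]_n) (O' : set 'rV[R]_k)
    (phi : 'rV[R]_n -> 'rV[R]_k) F : open O ->
  (forall y, O y -> O' (phi y)) -> (forall j, smooth_on O (fun y => phi y 0 j)) ->
  smooth_on O' F -> smooth_on O (fun y => F (phi y)).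
Proof. by move=> oO Op sp sF; apply: (smooth_generated oO Op sp); exact: gen_comp. Qed.

Lemma smooth_onD n (O : set 'rV[R]_n) f g : open O ->
  smooth_on O f -> smooth_on O g -> smooth_on O (fun y => f y + g y).
Proof.
move=> oO sf sg.
apply: (@smooth_generated n n O setT id) => //.
  by move=> j; exact: smooth_on_coord.
by apply: gen_add; exact: gen_base.
Qed.

Lemma smooth_onM n (O : set 'rV[R]_n) f g : open O ->
  smooth_on O f -> smooth_on O g -> smooth_on O (fun y => f y * g y).
Proof.
move=> oO sf sg.
apply: (@smooth_generated n n O setT id) => //.
  by move=> j; exact: smooth_on_coord.
by apply: gen_mul; exact: gen_base.
Qed.

End SmoothOn.

(** * Averages over the unit interval and Hadamard's lemma *)

Section Mean.
Context {R : realType}.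
Implicit Types g : R -> R.

Definition mean g : R := (\int[lebesgue_measure]_(t in `[0%R, 1%R]) g t)%R.

Definition cont01 g := forall t, 0 <= t <= 1 -> {for t, continuous g}.

Lemma cont01_within g : cont01 g -> {within `[0, 1], continuous g}.
Proof.
move=> cg; apply: continuous_in_subspaceT => t /set_mem /=.
by rewrite in_itv /=; exact: cg.
Qed.

Lemma cont01_integrable g : cont01 g ->
  lebesgue_measure.-integrable `[0%R, 1%R] (EFin \o g).
Proof.
move=> /cont01_within cg; apply: continuous_compact_integrable => //.
exact: segment_compact.
Qed.

Lemma meanD g h : cont01 g -> cont01 h ->
  mean (fun t => g t + h t) = mean g + mean h.
Proof. by move=> cg ch; apply: RintegralD => //; exact: cont01_integrable. Qed.

Lemma meanZ c g : cont01 g -> mean (fun t => c * g t) = c * mean g.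
Proof. by move=> cg; apply: RintegralZl => //; exact: cont01_integrable. Qed.

Lemma eq_mean g h : (forall t, 0 <= t <= 1 -> g t = h t) -> mean g = mean h.
Proof.
by move=> gh; apply: eq_Rintegral => t /set_mem/=; rewrite in_itv /=; exact: gh.
Qed.

Lemma mean_cst c : mean (fun=> c) = c.
Proof.
rewrite /mean Rintegral_cst//= lebesgue_measure_itv/= lte_fin ltr01.
by rewrite oppr0 adde0 mulr1.
Qed.

Lemma mean_sum n (r : seq 'I_n) (c : 'I_n -> R) (g : 'I_n -> R -> R) :
  (forall i, cont01 (g i)) ->
  cont01 (fun t => \sum_(i <- r) c i * g i t) /\
  mean (fun t => \sum_(i <- r) c i * g i t) = \sum_(i <- r) c i * mean (g i).
Proof.
move=> cg; elim: r => [|i r [IH1 IH2]].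
  under eq_fun do rewrite big_nil.
  by split; [move=> t _; exact: cst_continuous|rewrite mean_cst big_nil].
under eq_fun do rewrite big_cons.
have c1 : cont01 (fun t => c i * g i t).
  by move=> t t01; apply: continuousM; [exact: cst_continuous|exact: cg].
split; first by move=> t t01; apply: continuousD; [exact: c1|exact: IH1].
by rewrite meanD// IH2 big_cons meanZ.
Qed.

Lemma mean_le g e : cont01 g -> (forall t, 0 <= t <= 1 -> `|g t| <= e) ->
  `|mean g| <= e.
Proof.
move=> cg ge.
have cng : cont01 (fun t => `|g t|).
  by move=> t t01; apply: continuous_comp; [exact: cg|exact: norm_continuous].
apply: le_trans (le_normr_Rintegral _ _) _ => //; first exact: cont01_integrable.
rewrite -[leRHS](mean_cst e); apply: le_Rintegral => //.
- exact: cont01_integrable.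
- by apply: cont01_integrable => t _; exact: cst_continuous.
Qed.

Lemma mean_derive (F f : R -> R) : cont01 f ->
  (forall t : R, 0 <= t <= 1 -> is_derive t 1 F (f t)) -> mean f = F 1 - F 0.
Proof.
move=> cf dF.
have cF : cont01 F.
  move=> t /dF D; apply/differentiable_continuous/derivable1_diffP.
  exact: ex_derive.
rewrite /mean /Rintegral (@continuous_FTC2 _ f F)//.
- exact: cont01_within.
- split=> [t||].
  + by rewrite in_itv/= => /andP[/ltW t0 /ltW t1]; have [] := dF t _; rewrite ?t0.
  + by apply: cvg_at_right_filter; apply: cF; rewrite lexx ler01.
  + by apply: cvg_at_left_filter; apply: cF; rewrite lexx ler01.
- move=> t; rewrite in_itv/= => /andP[/ltW t0 /ltW t1].
  by rewrite derive1E; have [] := dF t _; rewrite ?t0.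
Qed.

End Mean.

Section Hadamard.
Context {R : realType} {n : nat}.
Variables (x : 'rV[R]_n) (e : R).
Local Notation B := (ball x e).
Implicit Types f : 'rV[R]_n -> R^o.

Definition seg (y : 'rV[R]_n) (t : R) : 'rV[R]_n := x + t *: (y - x).

Lemma seg_ball (y : 'rV[R]_n) t : B y -> 0 <= t <= 1 -> B (seg y t).
Proof.
rewrite -!ball_normE /= /ball_ /seg /= => By /andP[t0 t1].
rewrite opprD addrA subrr add0r normrN normrZ ger0_norm// -normrN opprB.
by apply: le_lt_trans By; rewrite ler_piMl.
Qed.

Lemma is_diff_ray (z w : 'rV[R]_n) (s : R) :
  is_diff s (fun s : R => z + s *: w) ( *:%R ^~ w).
Proof.
have -> : *:%R ^~ w = (0 : R -> 'rV[R]_n) + *:%R ^~ w :> (R -> 'rV[R]_n).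
  by apply/funext => u; rewrite /= [RHS]/GRing.add/= add0r.
exact: is_diffD.
Qed.

Lemma differentiable_ray f (z w : 'rV[R]_n) (s : R) :
  differentiable f (z + s *: w) ->
  is_derive s 1 (fun s => f (z + s *: w))
    (lincomb (fun i => 'D_(delta_mx 0 i) f (z + s *: w)) w).
Proof.
move=> df.
have dr := is_diff_ray z w s.
have dc : differentiable (f \o (fun s => z + s *: w)) s.
  exact: differentiable_comp.
split; first exact: diff_derivable.
rewrite deriveE// diff_comp//= diff_val scale1r.
rewrite [w in X in 'd f _ X]row_sum_delta linear_sum; apply: eq_bigr => i _.
by rewrite linearZ /= deriveE// mulrC.
Qed.

(** The weight t ^+ k makes the class of these averages stable under partial
    derivatives: differentiating in y multiplies the integrand by t. *)
Definition ray_mean (k : nat) f (y : 'rV[R]_n) : R^o :=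
  mean (fun t => t ^+ k * f (seg y t)).

Lemma seg_continuous y : continuous (seg y).
Proof.
by move=> t; apply: differentiable_continuous; have [] := is_diff_ray x (y - x) t.
Qed.

Lemma cont01_ray k f (y : 'rV[R]_n) : smooth_on B f -> B y ->
  cont01 (fun t => t ^+ k * f (seg y t)).
Proof.
move=> sf By t t01; apply: continuousM; first exact: exprn_continuous.
apply: continuous_comp; first exact: seg_continuous.
by apply/differentiable_continuous/(smooth_on_diff sf); exact: seg_ball.
Qed.

(** Differentiation under the integral sign.  The first order remainder of f is
    controlled by the mean value theorem on each ray, uniformly in t because
    the partial derivatives of f are continuous along the compact segment from
    x to y. *)
Lemma ray_mean_approx k f (y : 'rV[R]_n) : smooth_on B f -> B y ->
  forall eps : R, 0 < eps -> \forall h \near (0 : 'rV[R]_n),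
  `|ray_mean k f (h + y) - ray_mean k f y
    - lincomb (fun i => ray_mean k.+1 ('D_(delta_mx 0 i) f) y) h| <= eps * `|h|.
Proof.
move=> sf By eps eps0.
(* each of the n partial derivatives contributes at most eps' *)
pose eps' := eps / n.+1%:R.
have eps'0 : 0 < eps' by rewrite divr_gt0.
pose P (u : 'rV[R]_n) (t : R) := forall i,
  `|'D_(delta_mx 0 i) f (seg y t + u) - 'D_(delta_mx 0 i) f (seg y t)| <= eps'.
have : \forall u \near (0 : 'rV[R]_n), `[0, 1] `<=` P u.
  have /compact_near_coveringP cov := @segment_compact R 0 1.
  apply: (cov 'rV[R]_n (nbhs (0 : 'rV[R]_n)) P) => t /=; rewrite in_itv /= => t01.
  have Bt := seg_ball By t01.
  suff /filter_forall : forall i, \forall p \near ((t, 0) : R * 'rV[R]_n),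
    `|'D_(delta_mx 0 i) f (seg y p.1 + p.2) - 'D_(delta_mx 0 i) f (seg y p.1)| <= eps'.
    by apply: filterS => -[t' u].
  move=> i.
  have cg : {for seg y t, continuous ('D_(delta_mx 0 i) f)}.
    apply/differentiable_continuous/(smooth_on_diff _ Bt).
    exact: smooth_on_partial.
  have e2 : 0 < eps' / 2 by rewrite divr_gt0.
  have /cvgrPdist_le /(_ _ e2) N := cg.
  have C1 : (fun p : R * 'rV[R]_n => seg y p.1) @
      (((t : R), (0 : 'rV[R]_n)) : R * 'rV[R]_n) --> seg y t.
    by apply: cvg_comp (@cvg_fst _ _ _ _ _) _; exact: seg_continuous.
  have C2 : (fun p : R * 'rV[R]_n => seg y p.1 + p.2) @
      (((t : R), (0 : 'rV[R]_n)) : R * 'rV[R]_n) --> seg y t.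
    by rewrite -[X in _ --> X]addr0; apply: cvgD C1 _; exact: cvg_snd.
  have M1 : \forall p \near ((t, 0) : R * 'rV[R]_n),
    `|'D_(delta_mx 0 i) f (seg y t) - 'D_(delta_mx 0 i) f (seg y p.1)|
      <= eps' / 2 := C1 _ N.
  have M2 : \forall p \near ((t, 0) : R * 'rV[R]_n),
    `|'D_(delta_mx 0 i) f (seg y t) - 'D_(delta_mx 0 i) f (seg y p.1 + p.2)|
      <= eps' / 2 := C2 _ N.
  apply: filterS2 M1 M2 => -[t' u] /= I1 I2.
  rewrite distrC -(subrKA ('D_(delta_mx 0 i) f (seg y t))) [leRHS]splitr.
  by rewrite (le_trans (ler_normD _ _))// lerD// distrC.
have NB : \forall z \near y, B z.
  by apply: open_nbhs_nbhs; split => //; exact: ball_open.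
move/nbhs0P: NB.
move=> /nbhs_ballP[d1 /= d10 H1] /nbhs_ballP[d2 /= d20 H2].
apply/nbhs_ballP; exists (Num.min d1 d2); first by rewrite /= lt_min d10.
move=> h; rewrite -ball_normE /= /ball_ sub0r normrN lt_min => /andP[hd1 hd2].
have small (c : R) (w : 'rV[R]_n) : 0 <= c <= 1 -> `|c *: w| <= `|w|.
  by move=> /andP[c0 c1]; rewrite normrZ ger0_norm// ler_piMl.
have Byh c : 0 <= c <= 1 -> B (y + c *: h).
  move=> c01; apply: H1; rewrite -ball_normE /= /ball_ sub0r normrN.
  exact: le_lt_trans (small _ _ c01) hd1.
have segD t c : seg (y + c *: h) t = seg y t + c *: (t *: h).
  rewrite /seg scalerA mulrC -scalerA -[RHS]addrA -scalerDr; congr (_ + _ *: _).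
  by rewrite addrAC.
pose dfh t := lincomb (fun i => 'D_(delta_mx 0 i) f (seg y t)) (t *: h) : R.
have key t : 0 <= t <= 1 ->
    `|f (seg (h + y) t) - f (seg y t) - dfh t| <= eps * `|h|.
  move=> t01.
  have D c : 0 <= c <= 1 -> _ := fun c01 => @differentiable_ray f (seg y t) (t *: h) c
    (smooth_on_diff sf (eq_ind _ B (seg_ball (Byh c c01) t01) _ (segD t c))).
  have [c c01 Ec] : exists2 c : R, c \in `[0, 1] &
      f (seg y t + 1 *: (t *: h)) - f (seg y t + 0 *: (t *: h))
      = lincomb (fun i => 'D_(delta_mx 0 i) f (seg y t + c *: (t *: h))) (t *: h) * (1 - 0).
    apply: (@MVT_segment R (fun c => f (seg y t + c *: (t *: h)))) => //.
      move=> c; rewrite in_itv /= => /andP[c0 c1]; apply: D.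
      by rewrite !ltW.
    apply: cont01_within => c /D Dc.
    by apply/differentiable_continuous/derivable1_diffP; exact: ex_derive.
  rewrite in_itv /= in c01.
  rewrite -segD scale1r scale0r addr0 [y + h]addrC in Ec.
  rewrite Ec subr0 mulr1 /dfh /lincomb -sumrB.
  apply: (@le_trans _ _ (\sum_(i < n) eps' * `|h|)).
    apply: le_trans (ler_norm_sum _ _ _) _; apply: ler_sum => i _.
    rewrite -mulrBl normrM; apply: ler_pM => //.
      apply: H2; rewrite -?ball_normE /= /ball_ ?sub0r ?normrN.
        by apply: le_lt_trans (small _ _ c01) _; apply: le_lt_trans (small _ _ t01) hd2.
      by rewrite in_itv.
    apply: le_trans (small _ _ t01).
    rewrite [leRHS]/Num.Def.normr/= mx_normrE.
    exact: (le_bigmax _ (fun ij => `|(t *: h) ij.1 ij.2|) (0, i)).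
  rewrite sumr_const card_ord -mulr_natl mulrA ler_wpM2r// /eps'.
  rewrite mulrCA ler_piMr //; first exact: ltW.
  by rewrite ler_pdivrMr// mul1r ler_nat.
have cont_ray c (g : 'rV[R]_n -> R^o) : smooth_on B g -> 0 <= c <= 1 ->
    forall j, cont01 (fun t => t ^+ j * g (seg (y + c *: h) t)).
  by move=> sg c01 j; apply: cont01_ray => //; exact: Byh.
have cf1 := @cont_ray 1 f sf _ k; have cf0 := @cont_ray 0 f sf _ k.
rewrite scale1r in cf1; rewrite scale0r addr0 in cf0.
have {}cf1 : cont01 (fun t => t ^+ k * f (seg (h + y) t)).
  by rewrite addrC; apply: cf1; rewrite lexx ler01.
have {}cf0 : cont01 (fun t => t ^+ k * f (seg y t)).
  by apply: cf0; rewrite lexx ler01.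
have [c E] := @mean_sum _ _ (index_enum 'I_n) (fun i => h 0 i) _
  (fun i => @cont01_ray k.+1 _ _ (smooth_on_partial i sf) By).
have -> : ray_mean k f (h + y) - ray_mean k f y
    - lincomb (fun i => ray_mean k.+1 ('D_(delta_mx 0 i) f) y) h =
  mean (fun t => t ^+ k * (f (seg (h + y) t) - f (seg y t) - dfh t)).
  rewrite (@eq_mean _ _ (fun t => t ^+ k * f (seg (h + y) t) + (-1) * (t ^+ k * f (seg y t)
     + \sum_i h 0 i * (t ^+ k.+1 * 'D_(delta_mx 0 i) f (seg y t))))); last first.
    move=> t _; rewrite mulN1r opprD !mulrBr -!addrA; congr (_ + (_ - _)).
    rewrite /dfh /lincomb mulr_sumr; apply: eq_bigr => i _.
    by rewrite mxE exprS; ring.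
  have cD : cont01 (fun t => t ^+ k * f (seg y t)
     + \sum_i h 0 i * (t ^+ k.+1 * 'D_(delta_mx 0 i) f (seg y t))).
    by move=> t t01; apply: continuousD; [exact: cf0|exact: c].
  rewrite meanD ?meanZ ?meanD ?E//; last first.
    by move=> t t01; apply: continuousM; [exact: cst_continuous|exact: cD].
  rewrite mulN1r opprD addrA; congr (_ - _ - _).
  by apply: eq_bigr => i _; rewrite mulrC.
apply: mean_le => [t t01|t t01].
  have -> : (fun t => t ^+ k * (f (seg (h + y) t) - f (seg y t) - dfh t)) =
    (fun t => t ^+ k * f (seg (h + y) t) - t ^+ k * f (seg y t)
     - \sum_i h 0 i * (t ^+ k.+1 * 'D_(delta_mx 0 i) f (seg y t))).
    apply/funext => u; rewrite !mulrBr; congr (_ - _).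
    rewrite /dfh /lincomb mulr_sumr; apply: eq_bigr => i _.
    by rewrite mxE exprS; ring.
  by apply: continuousB; [apply: continuousB; [exact: cf1|exact: cf0]|exact: c].
rewrite normrM; apply: le_trans (key t t01).
rewrite ler_piMl// normrX exprn_ile1//; case/andP: t01 => t0 t1.
by rewrite ger0_norm.
Qed.

Lemma smooth_ray_mean k f : smooth_on B f -> smooth_on B (ray_mean k f).
Proof.
move=> sf.
pose S g := exists k f, smooth_on B f /\ g = ray_mean k f.
apply: (@smooth_on_coind _ _ _ S); first exact: ball_open.
  move=> _ [{}k [{}f [{}sf ->]]].
  have D y : B y -> _ := fun By => differentiable_of_approx (ray_mean_approx k sf By).
  split=> [y /D[]//|i].
  exists (ray_mean k.+1 ('D_(delta_mx 0 i) f)).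
    by exists k.+1, ('D_(delta_mx 0 i) f); split => //; exact: smooth_on_partial.
  by move=> y; rewrite inE => /D[_]; exact.
by exists k, f.
Qed.

(** Integrate the derivative of t |-> f(x + t (y - x)) over [0, 1]: the g_i are
    the averages of the partial derivatives of f over the rays from x. *)
Lemma Hadamard f : smooth_on B f -> exists g : 'I_n -> 'rV[R]_n -> R^o,
  [/\ forall i, smooth_on B (g i),
      forall i, g i x = 'D_(delta_mx 0 i) f x &
      forall y, B y -> f y = f x + \sum_i (y 0 i - x 0 i) * g i y].
Proof.
move=> sf; exists (fun i => ray_mean 0 ('D_(delta_mx 0 i) f)); split.
- by move=> i; apply/smooth_ray_mean/smooth_on_partial.
- move=> i; rewrite /ray_mean -[RHS]mean_cst; apply: eq_mean => t _.
  by rewrite expr0 mul1r /seg subrr scaler0 addr0.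
move=> y By; apply/eqP; rewrite addrC -subr_eq; apply/eqP.
pose df t := lincomb (fun i => 'D_(delta_mx 0 i) f (seg y t)) (y - x) : R.
have c0 i : cont01 (fun t => 'D_(delta_mx 0 i) f (seg y t)).
  have := @cont01_ray 0 _ _ (smooth_on_partial i sf) By.
  by under eq_fun do rewrite expr0 mul1r.
have [c E] := @mean_sum _ _ (index_enum 'I_n) (fun i => y 0 i - x 0 i) _ c0.
have {}E : mean (fun t => \sum_i (y 0 i - x 0 i) * 'D_(delta_mx 0 i) f (seg y t)) =
     \sum_i (y 0 i - x 0 i) * ray_mean 0 ('D_(delta_mx 0 i) f) y.
  rewrite E; apply: eq_bigr => i _; congr (_ * _).
  by apply: eq_mean => t _; rewrite expr0 mul1r.
rewrite -E.
have F1 : f y = f (seg y 1) by rewrite /seg scale1r addrC subrK.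
have F0 : f x = f (seg y 0) by rewrite /seg scale0r addr0.
rewrite F1 [in LHS]F0; symmetry.
apply: (@mean_derive _ (fun t => f (seg y t))) => // t t01.
have := @differentiable_ray f x (y - x) t (smooth_on_diff sf (seg_ball By t01)).
by congr is_derive; apply: eq_bigr => i _; rewrite !mxE mulrC.
Qed.

End Hadamard.

(** * Smooth functions and tangent vectors on a manifold *)

Section CinftyAt.
Context {R : realType}.

Lemma Cinfty_at_open n (x : 'rV[R]_n) f :
  Cinfty_at x f <-> exists O : set 'rV[R]_n, [/\ open O, O x & smooth_on O f].
Proof.
split=> [/Cinfty_atP[e [e0 sf]]|[ O [oO Ox sf]]].
  by exists (ball x e); split => //; [exact: ball_open|exact: ballxx].
by have := open_nbhs_nbhs (conj oO Ox); apply: filterS => y Oy s; exact: sf.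
Qed.

Lemma Cinfty_at_near n (x : 'rV[R]_n) f :
  Cinfty_at x f -> \forall y \near x, Cinfty_at y f.
Proof.
move=> /Cinfty_at_open[ O [oO Ox sf]].
have := open_nbhs_nbhs (conj oO Ox); apply: filterS => y Oy.
by apply/Cinfty_at_open; exists O.
Qed.

Lemma Cinfty_at_ext n (x : 'rV[R]_n) f g : {near x, f =1 g} ->
  Cinfty_at x f -> Cinfty_at x g.
Proof.
move=> fg /Cinfty_at_open[ O [oO Ox sf]].
have [ O' [oO' O'x] fg'] : exists2 O', open_nbhs x O' & {in O', f =1 g}.
  have : nbhs x [set y | f y = g y] by exact: fg.
  by rewrite nbhsE => -[ O' oO' H]; exists O' => // y /set_mem; exact: H.
apply/Cinfty_at_open; exists (O `&` O'); split=> //; first exact: openI.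
apply: (@smooth_on_ext _ _ _ f); first exact: openI.
  by move=> y; rewrite inE => -[_ ?]; apply: fg'; rewrite inE.
by apply: smooth_on_sub sf => y [].
Qed.

Lemma Cinfty_at_cst n (x : 'rV[R]_n) (c : R) : Cinfty_at x (fun=> c).
Proof.
apply/Cinfty_at_open; exists setT; split=> //; first exact: openT.
exact/smooth_on_cst/openT.
Qed.

Lemma Cinfty_at_coord n (x : 'rV[R]_n) i : Cinfty_at x (fun y => y 0 i).
Proof.
apply/Cinfty_at_open; exists setT; split=> //; first exact: openT.
exact/smooth_on_coord/openT.
Qed.

Lemma CinftyD n (x : 'rV[R]_n) f g :
  Cinfty_at x f -> Cinfty_at x g -> Cinfty_at x (fun y => f y + g y).
Proof.
move=> /Cinfty_at_open[ O [oO Ox sf]] /Cinfty_at_open[ O' [oO' Ox' sg]].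
apply/Cinfty_at_open; exists (O `&` O'); split=> //; first exact: openI.
apply: smooth_onD; first exact: openI.
  by apply: smooth_on_sub sf => y [].
by apply: smooth_on_sub sg => y [].
Qed.

Lemma CinftyM n (x : 'rV[R]_n) f g :
  Cinfty_at x f -> Cinfty_at x g -> Cinfty_at x (fun y => f y * g y).
Proof.
move=> /Cinfty_at_open[ O [oO Ox sf]] /Cinfty_at_open[ O' [oO' Ox' sg]].
apply/Cinfty_at_open; exists (O `&` O'); split=> //; first exact: openI.
apply: smooth_onM; first exact: openI.
  by apply: smooth_on_sub sf => y [].
by apply: smooth_on_sub sg => y [].
Qed.

Lemma Cinfty_at_continuous n (x : 'rV[R]_n) f :
  Cinfty_at x f -> {for x, continuous f}.
Proof. by move=> /nbhs_singleton /(_ [::]) /differentiable_continuous. Qed.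

Lemma continuous_rV (T : topologicalType) k (phi : T -> 'rV[R]_k) x :
  (forall j, {for x, continuous (fun y => phi y 0 j : R^o)}) -> {for x, continuous phi}.
Proof.
move=> H; apply/cvgrPdist_le => e e0.
have : \forall y \near x, forall j, `|phi x 0 j - phi y 0 j| <= e.
  by apply: filter_forall => j; have /cvgrPdist_le := H j; apply.
apply: filterS => y Hy.
rewrite /Num.Def.normr/= mx_normrE (bigmax_le _ (ltW e0))// => -[i j] _ /=.
by rewrite ord1 !mxE.
Qed.

Lemma Cinfty_at_comp n k (x : 'rV[R]_n) (phi : 'rV[R]_n -> 'rV[R]_k) F :
  (forall j, Cinfty_at x (fun y => phi y 0 j)) -> Cinfty_at (phi x) F ->
  Cinfty_at x (fun y => F (phi y)).
Proof.
move=> sphi /Cinfty_at_open[ O' [oO' O'x sF]].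
have cphi : {for x, continuous phi}.
  by apply: continuous_rV => j; exact: Cinfty_at_continuous.
have N1 : \forall y \near x, O' (phi y).
  by apply: cphi; exact: open_nbhs_nbhs.
have N2 : \forall y \near x, forall j s,
    differentiable (partials (fun y => phi y 0 j) s) y.
  exact: (@filter_forall _ _ (fun j y => forall s,
    differentiable (partials (fun y => phi y 0 j) s) y) _ _ sphi).
have [ O [oO Ox] HO] : exists2 O, open_nbhs x O & forall y, O y ->
   O' (phi y) /\ forall j s, differentiable (partials (fun y => phi y 0 j) s) y.
  have : nbhs x [set y | O' (phi y) /\
     forall j s, differentiable (partials (fun y => phi y 0 j) s) y].
    exact: filterI N1 N2.
  rewrite nbhsE => -[ O oO H]; exists O => // y; exact: H.
apply/Cinfty_at_open; exists O; split=> //.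
apply: (smooth_on_comp oO _ _ sF) => [y /HO[]//|j y /HO[_ H] s].
exact: H.
Qed.

End CinftyAt.

Section SmoothFunctions.
Context {R : realType} {n : nat} {X : smoothSpace R}.
Hypothesis mX : is_manifold n X.
Implicit Types (p q : X) (f g h : X -> R^o).

(** The axioms of a sheaf of algebras of continuous functions, transported from
    the algebra of smooth functions on R^n through a chart. *)
Lemma smooth_near_eq p f g : {near p, f =1 g} -> smooth_at p f -> smooth_at p g.
Proof.
move=> fg; have [_ _ /(_ p)] := mX.
move=> [U [V [phi [psi [[oU Up oV] [H1 H2] [c1 c2] S]]]]].
have [Vp pp] := H1 p Up.
move=> /(S _ _ Up) sf; apply/S => //; apply: Cinfty_at_ext sf.
have cp : psi @ phi p --> p by have := c2 _ Vp; rewrite /prop_for /continuous_at pp.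
exact: (cp _ fg).
Qed.

Lemma smooth_near p f : smooth_at p f -> \forall q \near p, smooth_at q f.
Proof.
have [_ _ /(_ p)] := mX.
move=> [U [V [phi [psi [[oU Up oV] [H1 H2] [c1 c2] S]]]]].
move=> /(S _ _ Up) /Cinfty_at_near N.
have {}N : \forall q \near p, Cinfty_at (phi q) (fun y => f (psi y)) := c1 _ Up _ N.
have NU : \forall q \near p, U q by exact: open_nbhs_nbhs.
by apply: filterS2 N NU => q sq Uq; exact/S.
Qed.

Lemma smooth_continuous p f : smooth_at p f -> {for p, continuous f}.
Proof.
have [_ _ /(_ p)] := mX.
move=> [U [V [phi [psi [[oU Up oV] [H1 H2] [c1 c2] S]]]]].
move=> /(S _ _ Up) /Cinfty_at_continuous cf.
have [_ pp] := H1 p Up.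
have C : {for p, continuous ((fun y => f (psi y)) \o phi)}.
  by apply: continuous_comp => //; exact: c1.
rewrite /prop_for /continuous_at /= pp in C.
apply: cvg_trans C; apply: near_eq_cvg.
have NU : \forall q \near p, U q by exact: open_nbhs_nbhs.
by apply: filterS NU => q /H1[_ /= ->].
Qed.

Lemma smooth_comp k p (a : 'I_k -> X -> R^o) (F : 'rV[R]_k -> R^o) :
  (forall i, smooth_at p (a i)) -> Cinfty_at (\row_i a i p) F ->
  smooth_at p (fun q => F (\row_i a i q)).
Proof.
have [_ _ /(_ p)] := mX.
move=> [U [V [phi [psi [[oU Up oV] [H1 H2] [c1 c2] S]]]]] sa sF.
have [_ pp] := H1 p Up.
apply/S => //; apply: (@Cinfty_at_comp _ _ _ _ (fun y => \row_i a i (psi y))).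
  by move=> j; under eq_fun do rewrite mxE; exact/S.
by rewrite pp.
Qed.

Lemma smooth_cst p (c : R) : smooth_at p (fun=> c).
Proof.
have [_ _ /(_ p)] := mX.
move=> [U [V [phi [psi [[oU Up oV] _ _ S]]]]].
by apply/S => //; exact: Cinfty_at_cst.
Qed.

Lemma smoothD p f g : smooth_at p f -> smooth_at p g ->
  smooth_at p (fun q => f q + g q).
Proof.
have [_ _ /(_ p)] := mX.
move=> [U [V [phi [psi [[oU Up oV] [H1 H2] [c1 c2] S]]]]].
by move=> /(S _ _ Up) sf /(S _ _ Up) sg; apply/S => //; exact: CinftyD.
Qed.

Lemma smoothM p f g : smooth_at p f -> smooth_at p g ->
  smooth_at p (fun q => f q * g q).
Proof.
have [_ _ /(_ p)] := mX.
move=> [U [V [phi [psi [[oU Up oV] [H1 H2] [c1 c2] S]]]]].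
by move=> /(S _ _ Up) sf /(S _ _ Up) sg; apply/S => //; exact: CinftyM.
Qed.

Lemma smoothZ p (c : R) f : smooth_at p f -> smooth_at p (fun q => c * f q).
Proof. by move=> sf; apply: smoothM => //; exact: smooth_cst. Qed.

Lemma smooth_sum (I : Type) (r : seq I) p (F : I -> X -> R^o) :
  (forall i, smooth_at p (F i)) -> smooth_at p (fun q => \sum_(i <- r) F i q).
Proof.
move=> sF; elim: r => [|i r IH].
  by under eq_fun do rewrite big_nil; exact: smooth_cst.
by under eq_fun do rewrite big_cons; exact: smoothD.
Qed.

Lemma tangentP p (v : tangent p) :
  [/\ forall (a : R) f g, smooth_at p f -> smooth_at p g ->
            v (fun x => a * f x + g x) = a * v f + v g,
          forall f g, smooth_at p f -> smooth_at p g ->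
            v (fun x => f x * g x) = v f * g p + f p * v g &
          forall f, ~ smooth_at p f -> v f = 0].
Proof. by case: v => v /= /asboolP. Qed.

Lemma tangent_nsmooth p (v : tangent p) f : ~ smooth_at p f -> v f = 0.
Proof. by have [_ _] := tangentP v; apply. Qed.

Lemma tangentM p (v : tangent p) f g : smooth_at p f -> smooth_at p g ->
  v (fun x => f x * g x) = v f * g p + f p * v g.
Proof. by have [_ + _] := tangentP v; apply. Qed.

Lemma tangent_lin p (v : tangent p) (a : R) f g : smooth_at p f -> smooth_at p g ->
  v (fun x => a * f x + g x) = a * v f + v g.
Proof. by have [+ _ _] := tangentP v; apply. Qed.

Lemma tangentD p (v : tangent p) f g : smooth_at p f -> smooth_at p g ->
  v (fun x => f x + g x) = v f + v g.
Proof.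
move=> sf sg; rewrite -[v f]mul1r -tangent_lin//.
by congr (tangent_fun v _); apply/funext => x; rewrite mul1r.
Qed.

Lemma tangent_cst p (v : tangent p) (c : R) : v (fun=> c) = 0.
Proof.
have s1 := smooth_cst p 1.
have v1 : v (fun=> 1) = 0.
  have := tangentM v s1 s1; under eq_fun do rewrite mulr1.
  rewrite mulr1 mul1r => /eqP; rewrite -subr_eq0 opprD addrA subrr add0r.
  by rewrite oppr_eq0 => /eqP.
have := tangent_lin v (c - 1) s1 s1; rewrite v1 mulr0 addr0 => <-.
by congr (tangent_fun v _); apply/funext => x; rewrite mulr1 subrK.
Qed.

Lemma tangentZ p (v : tangent p) (c : R) f : smooth_at p f ->
  v (fun x => c * f x) = c * v f.
Proof.
by move=> sf; rewrite tangentM ?tangent_cst ?mul0r ?add0r//; exact: smooth_cst.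
Qed.

Lemma tangent_sum (I : Type) (r : seq I) p (v : tangent p) (F : I -> X -> R^o) :
  (forall i, smooth_at p (F i)) ->
  v (fun q => \sum_(i <- r) F i q) = \sum_(i <- r) v (F i).
Proof.
move=> sF; elim: r => [|i r IH].
  by under eq_fun do rewrite big_nil; rewrite tangent_cst big_nil.
under eq_fun do rewrite big_cons.
by rewrite big_cons tangentD ?IH//; exact: smooth_sum.
Qed.

(** Derivations are local.  The indicator function k of the set where f and g
    agree is smooth at p, being constant near p; k = k * k gives v k = 0, hence
    v f = v (f k) = v (g k) = v g. *)
Lemma tangent_near_eq p (v : tangent p) f g : {near p, f =1 g} -> v f = v g.
Proof.
move=> fg; have [sf|nf] := pselect (smooth_at p f); last first.
  rewrite !tangent_nsmooth// => sg; apply: nf; apply: smooth_near_eq sg.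
  by apply: filterS fg => q ->.
have sg := smooth_near_eq fg sf.
pose k q : R^o := if `[< f q = g q >] then 1 else 0.
have kp : k p = 1 by rewrite /k (nbhs_singleton fg) asboolT.
have sk : smooth_at p k.
  apply: (smooth_near_eq _ (smooth_cst p 1)).
  by apply: filterS fg => q fgq; rewrite /k asboolT.
have vk : v k = 0.
  have := tangentM v sk sk.
  have -> : (fun x => k x * k x) = k.
    by apply/funext => q; rewrite /k; case: ifP; rewrite ?mulr0 ?mulr1.
  rewrite kp mulr1 mul1r => /eqP; rewrite -subr_eq0 opprD addrA subrr add0r.
  by rewrite oppr_eq0 => /eqP.
have : v (fun x => f x * k x) = v (fun x => g x * k x).
  congr (tangent_fun v _); apply/funext => q; rewrite /k.
  by case: asboolP => [->//|_]; rewrite !mulr0.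
by rewrite !tangentM// vk kp !mulr1 !mulr0 !addr0.
Qed.

(** Chain rule for derivations: by Hadamard's lemma F o a - F (a p) is a sum of
    products (a_i - a_i(p)) (g_i o a) whose first factor vanishes at p. *)
Lemma tangent_comp k p (v : tangent p) (a : 'I_k -> X -> R^o) (F : 'rV[R]_k -> R^o) :
  (forall i, smooth_at p (a i)) -> Cinfty_at (\row_i a i p) F ->
  v (fun q => F (\row_i a i q)) =
  \sum_i 'D_(delta_mx 0 i) F (\row_i a i p) * v (a i).
Proof.
move=> sa /Cinfty_atP[e [e0 sF]].
set y0 := \row_i a i p in sF *.
have [g [sg g0 E]] := Hadamard sF.
have ca : {for p, continuous (fun q => \row_i a i q)}.
  apply: continuous_rV => j.
  have -> : (fun q => (\row_i a i q : 'rV[R]_k) 0 j : R^o) = a j.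
    by apply/funext => q; rewrite mxE.
  exact: smooth_continuous.
have sga i : smooth_at p (fun q => g i (\row_i a i q)).
  apply: smooth_comp => //; apply/Cinfty_atP; exists e; split=> //; exact: sg.
have sya i : smooth_at p (fun q => a i q + (- y0 0 i)).
  by apply: smoothD => //; exact: smooth_cst.
rewrite (@tangent_near_eq _ _ _
  (fun q => F y0 + \sum_i (a i q + - y0 0 i) * g i (\row_i a i q))); last first.
  have : \forall q \near p, ball y0 e (\row_i a i q) by apply: ca; exact: nbhsx_ballx.
  apply: filterS => q /E ->; congr (_ + _).
  by apply: eq_bigr => i _; rewrite !mxE.
rewrite tangentD; [|exact: smooth_cst|by apply: smooth_sum => i; exact: smoothM].
rewrite tangent_cst add0r tangent_sum; last by move=> i; exact: smoothM.
apply: eq_bigr => i _; rewrite tangentM// tangentD//; last exact: smooth_cst.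
by rewrite tangent_cst addr0 g0 mxE subrr mul0r addr0 mulrC.
Qed.

Lemma tangent_eq p (u v : tangent p) :
  (forall f, smooth_at p f -> u f = v f) -> u = v.
Proof.
move=> uv; apply: val_inj; apply/funext => f /=.
by have [/uv//|nf] := pselect (smooth_at p f); rewrite !tangent_nsmooth.
Qed.

Lemma tangent_linE p (a : R) (u v : tangent p) f :
  (a *: u + v) f = a * u f + v f.
Proof. by []. Qed.

Lemma tangent_sumE (I : Type) (r : seq I) p (c : I -> R) (u : I -> tangent p) f :
  (\sum_(i <- r) c i *: u i) f = \sum_(i <- r) c i * u i f.
Proof.
elim: r => [|i r IH]; first by rewrite !big_nil.
by rewrite !big_cons tangent_linE IH.
Qed.

(** Local coordinates [crd] with their coordinate vector fields [vec]; the last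
    two fields say that they form dual bases.  All later computations refer to
    a frame only, not to the charts from which it comes. *)
Record frame p := Frame {
  dom : set X;
  crd : 'I_n -> X -> R^o;
  vec : 'I_n -> vector_field X;
  frame_open : open dom;
  frame_mem : dom p;
  crd_smooth : forall q i, dom q -> smooth_at q (crd i);
  vec_smooth : forall q i, dom q -> smooth_vf_at q (vec i);
  vec_crd : forall q i j, dom q -> vec i q (crd j) = (i == j)%:R;
  vec_span : forall q (v : tangent q), dom q -> v = \sum_i v (crd i) *: vec i q }.

(** The coordinate fields differentiate in a chart; they span by the chain rule
    [tangent_comp] applied to f = (f o psi) o phi. *)
Lemma frame_exists p : exists _ : frame p, True.
Proof.
have [_ _ /(_ p)] := mX.
move=> [U [V [phi [psi [[oU Up oV] [H1 H2] [c1 c2] S]]]]].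
pose x i q : R^o := phi q 0 i.
pose E i q : tangent q := insubd (0 : tangent q) (fun f : X -> R^o =>
  if `[< smooth_at q f >] then 'D_(delta_mx 0 i) (fun y => f (psi y)) (phi q) else 0).
have phix q : phi q = \row_i x i q by apply/rowP => i; rewrite mxE.
have phipsi q : U q -> \forall y \near phi q, phi (psi y) = y.
  move=> Uq; have [Vq _] := H1 q Uq.
  by apply: filterS (open_nbhs_nbhs (conj oV Vq)) => y /H2[].
have EE q i f : U q -> smooth_at q f ->
    E i q f = 'D_(delta_mx 0 i) (fun y => f (psi y)) (phi q).
  move=> Uq sf; have [_ pq] := H1 q Uq; rewrite /E /insubd insubT /=; last by rewrite asboolT.
  apply/asboolP; split.
  - move=> a g h sg sh; rewrite !asboolT//; last by apply: smoothD => //; exact: smoothZ.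
    have /nbhs_singleton /(_ [::])/= dg := iffLR (S _ _ Uq) sg.
    have /nbhs_singleton /(_ [::])/= dh := iffLR (S _ _ Uq) sh.
    rewrite deriveD ?deriveMl//; try exact: diff_derivable.
    by apply: derivableM; [exact: derivable_cst|exact: diff_derivable].
  - move=> g h sg sh; rewrite !asboolT//; last exact: smoothM.
    have /nbhs_singleton /(_ [::])/= dg := iffLR (S _ _ Uq) sg.
    have /nbhs_singleton /(_ [::])/= dh := iffLR (S _ _ Uq) sh.
    rewrite deriveM; try exact: diff_derivable.
    by rewrite pq addrC; congr (_ + _); rewrite mulrC.
  - by move=> g ng; rewrite asboolF.
have sx q i : U q -> smooth_at q (x i).
  move=> Uq; apply/S => //; apply: Cinfty_at_ext (Cinfty_at_coord _ i).
  by apply: filterS (phipsi q Uq) => y; rewrite /x => ->.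
have Up' q : U q -> \forall q' \near q, U q' by move=> Uq; exact: open_nbhs_nbhs.
have Espan q (v : tangent q) : U q -> v = \sum_i v (x i) *: E i q.
  move=> Uq; apply: tangent_eq => f sf; rewrite tangent_sumE.
  have [_ pq] := H1 q Uq.
  rewrite (@tangent_near_eq _ _ _ (fun q => f (psi (\row_i x i q)))); last first.
    by apply: filterS (Up' q Uq) => q' /H1[_]; rewrite -phix => ->.
  rewrite (@tangent_comp _ _ _ x (fun y => f (psi y)))//; last 2 first.
  - by move=> i; exact: sx.
  - by rewrite -phix; exact/S.
  by apply: eq_bigr => i _; rewrite EE// -phix mulrC.
have svec q i : U q -> smooth_vf_at q (E i).
  move=> Uq f sf.
  apply: (@smooth_near_eq _ (fun q => 'D_(delta_mx 0 i) (fun y => f (psi y)) (phi q))).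
    by apply: filterS2 (smooth_near sf) (Up' q Uq) => q' sq' Uq'; rewrite EE.
  apply/S => //.
  apply: (@Cinfty_at_ext _ _ _ ('D_(delta_mx 0 i) (fun y => f (psi y)))).
    by apply: filterS (phipsi q Uq) => y ->.
  have /Cinfty_at_open[ O [oO Ox sO]] := iffLR (S _ _ Uq) sf.
  apply/Cinfty_at_open; exists O; split => //; exact: smooth_on_partial.
have cvec q i j : U q -> E i q (x j) = (i == j)%:R.
  move=> Uq; rewrite EE//; last exact: sx.
  rewrite (@near_eq_derive _ _ _ _ (fun y : 'rV[R]_n => y 0 j : R^o)); last first.
    by apply: filterS (phipsi q Uq) => y; rewrite /x => ->.
  by rewrite derive_coord eq_sym.
by exists (@Frame p U x E oU Up sx svec cvec Espan).
Qed.

End SmoothFunctions.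

Arguments frame_open {R n X p} f.
Arguments frame_mem {R n X p} f.
Arguments crd_smooth {R n X p} f {q} i _.
Arguments vec_smooth {R n X p} f {q} i _.
Arguments vec_crd {R n X p} f {q} i j _.
Arguments vec_span {R n X p} f {q} v _.
Arguments frame {R} n {X} p.

(** * Differentials, Lie brackets and 2-forms *)

Section Differential.
Context {R : realType} {n : nat} {X Y : smoothSpace R}.
Hypothesis mY : is_manifold n Y.

Lemma dmapE (f : X -> Y) (p : X) (v : tangent p) (h : Y -> R^o) :
  smooth_map_at f p -> smooth_at (f p) h -> dmap f v h = v (fun x => h (f x)).
Proof.
move=> sf sh; rewrite /dmap /insubd insubT /=; last by rewrite asboolT.
apply/asboolP; split.
- move=> a g k sg sk; rewrite !asboolT//; last exact: (smoothD mY (smoothZ mY a sg) sk).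
  by apply: tangent_lin; exact: sf.
- move=> g k sg sk; rewrite !asboolT//; last exact: (smoothM mY).
  by apply: tangentM; exact: sf.
- by move=> g ng; rewrite asboolF.
Qed.

Lemma dmap_linear (f : X -> Y) (p : X) (a : R) (u v : tangent p) :
  smooth_map_at f p -> dmap f (a *: u + v) = a *: dmap f u + dmap f v.
Proof.
move=> sf; apply: tangent_eq => h sh.
by rewrite tangent_linE !dmapE.
Qed.

Lemma dmap0 (f : X -> Y) (p : X) : smooth_map_at f p -> dmap f (0 : tangent p) = 0.
Proof. by move=> sf; apply: tangent_eq => h sh; rewrite dmapE. Qed.

End Differential.

Section Chain.
Context {R : realType} {n k : nat} {X Y Z : smoothSpace R}.
Hypotheses (mY : is_manifold n Y) (mZ : is_manifold k Z).

Lemma smooth_map_comp (f : X -> Y) (g : Y -> Z) (p : X) :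
  smooth_map_at f p -> smooth_map_at g (f p) -> smooth_map_at (fun x => g (f x)) p.
Proof. by move=> sf sg h /sg /sf. Qed.

Lemma dmap_comp (f : X -> Y) (g : Y -> Z) (p : X) (v : tangent p) :
  smooth_map_at f p -> smooth_map_at g (f p) ->
  dmap g (dmap f v) = dmap (fun x => g (f x)) v.
Proof.
move=> sf sg; apply: (@tangent_eq _ _ (g (f p))) => h sh.
rewrite (dmapE mZ)// (dmapE mY)//; last exact: sg.
by rewrite (dmapE mZ)//; exact: smooth_map_comp.
Qed.

End Chain.

Section Forms.
Context {R : realType} {n : nat} {X : smoothSpace R}.
Hypothesis mX : is_manifold n X.

Lemma lie_bracketE (p : X) (V W : vector_field X) (f : X -> R^o) :
  smooth_vf_at p V -> smooth_vf_at p W -> smooth_at p f ->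
  lie_bracket V W p f = V p (fun q => W q f) - W p (fun q => V q f).
Proof.
move=> sV sW sf; rewrite /lie_bracket /insubd insubT /=; last by rewrite asboolT.
apply/asboolP; split.
- move=> a g h sg sh; rewrite !asboolT//; last exact: (smoothD mX (smoothZ mX a sg) sh).
  have lin (U : vector_field X) : {near p,
      (fun q => U q (fun x => a * g x + h x)) =1 (fun q => a * U q g + U q h)}.
    by apply: filterS2 (smooth_near mX sg) (smooth_near mX sh) => q; exact: tangent_lin.
  rewrite (tangent_near_eq mX _ (lin V)) (tangent_near_eq mX _ (lin W)).
  rewrite !tangent_lin; try by [exact: sV|exact: sW].
  by ring.
- move=> g h sg sh; rewrite !asboolT//; last exact: (smoothM mX).
  have lei (U : vector_field X) : {near p,
      (fun q => U q (fun x => g x * h x)) =1 (fun q => U q g * h q + g q * U q h)}.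
    by apply: filterS2 (smooth_near mX sg) (smooth_near mX sh) => q; exact: tangentM.
  rewrite (tangent_near_eq mX _ (lei V)) (tangent_near_eq mX _ (lei W)).
  have [sVg sVh] := (sV _ sg, sV _ sh).
  have [sWg sWh] := (sW _ sg, sW _ sh).
  rewrite !tangentD; try by apply: (smoothM mX).
  rewrite !tangentM//.
  by ring.
- by move=> g ng; rewrite asboolF.
Qed.

Lemma is_two_formD (a : R) (w : two_form X) : is_two_form w ->
  forall p (u v1 v2 : tangent p), w p u (a *: v1 + v2) = a * w p u v1 + w p u v2.
Proof. by move=> [H _ _ _] p u v1 v2; rewrite H. Qed.

Lemma two_form0 (w : two_form X) : is_two_form w ->
  forall p (u : tangent p), w p u 0 = 0.
Proof.
move=> W p u; have := is_two_formD (-1) W u 0 0.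
by rewrite scaler0 addr0 mulN1r addNr.
Qed.

Lemma two_form_sum (w : two_form X) (I : Type) (r : seq I) p (u : tangent p)
    (c : I -> R) (v : I -> tangent p) :
  is_two_form w ->
  w p u (\sum_(i <- r) c i *: v i) = \sum_(i <- r) c i * w p u (v i).
Proof.
move=> W; elim: r => [|i r IH]; first by rewrite !big_nil two_form0.
by rewrite !big_cons is_two_formD// IH.
Qed.

Lemma two_form_antisym (w : two_form X) : is_two_form w ->
  forall p (u v : tangent p), w p u v = - w p v u.
Proof. by case. Qed.

Lemma two_form_sum2 (w : two_form X) (I : finType) p (a b : I -> R)
    (v : I -> tangent p) :
  is_two_form w ->
  w p (\sum_i a i *: v i) (\sum_i b i *: v i) =
  \sum_i \sum_j a i * b j * w p (v i) (v j).
Proof.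
move=> W; rewrite two_form_sum// exchange_big /=; apply: eq_bigr => j _.
rewrite two_form_antisym// two_form_sum// mulrN mulr_sumr -sumrN.
apply: eq_bigr => i _; rewrite (two_form_antisym W (v j)); ring.
Qed.

Lemma closed_two_form_lin (a b : R) (w1 w2 : two_form X) :
  closed_two_form w1 -> closed_two_form w2 ->
  closed_two_form (fun p u v => a * w1 p u v + b * w2 p u v).
Proof.
move=> [W1 c1] [W2 c2]; split.
  have [l1 d1 s1 sm1] := W1; have [l2 d2 s2 sm2] := W2; split.
  - by move=> p u c v1 v2; rewrite l1 l2 /GRing.scale/=; ring.
  - by move=> p u; rewrite d1 d2 !mulr0 addr0.
  - by move=> p u v; rewrite s1 s2; ring.
  - move=> p U V sU sV.
    by apply: (smoothD mX); apply: (smoothZ mX); [exact: sm1|exact: sm2].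
move=> p U V W sU sV sW.
have [_ _ _ sm1] := W1; have [_ _ _ sm2] := W2.
have L (T A B : vector_field X) : smooth_vf_at p A -> smooth_vf_at p B ->
    T p (fun q => a * w1 q (A q) (B q) + b * w2 q (A q) (B q)) =
    a * T p (fun q => w1 q (A q) (B q)) + b * T p (fun q => w2 q (A q) (B q)).
  move=> sA sB; have S1 := sm1 _ _ _ sA sB; have S2 := sm2 _ _ _ sA sB.
  by rewrite tangent_lin ?(tangentZ mX)//; exact: (smoothZ mX).
rewrite /ext_d2 !L//.
transitivity (a * ext_d2 w1 U V W p + b * ext_d2 w2 U V W p).
  by rewrite /ext_d2; ring.
by rewrite c1// c2// !mulr0 addr0.
Qed.

End Forms.

(** * Pull-backs of closed 2-forms *)

Section Pullback.
Context {R : realType} {n m : nat} {X Y : smoothSpace R}.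
Hypotheses (mX : is_manifold n X) (mY : is_manifold m Y).
Variable f : X -> Y.
Hypothesis sf : smooth_map f.

(** If N is a neighbourhood of f p, its indicator function is smooth at f p, so
    its pull-back is smooth, hence continuous, at p. *)
Lemma smooth_map_continuous : continuous f.
Proof.
move=> p N Nfp; rewrite /= nbhs_filterE.
pose k q : R^o := if `[< N q >] then 1 else 0.
have sk : smooth_at (f p) k.
  apply: (smooth_near_eq mY _ (smooth_cst mY (f p) 1)).
  by apply: filterS Nfp => q Nq; rewrite /k asboolT.
have := smooth_continuous mX (sf sk).
move=> /cvgrPdist_lt /(_ 1 ltr01).
apply: filterS => q; rewrite /k (asboolT (nbhs_singleton Nfp)).
by case: asboolP => // _; rewrite subr0 normr1 ltxx.
Qed.

Variable alpha : two_form Y.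
Hypothesis calpha : closed_two_form alpha.

Lemma pullback_frame p (F : frame m (f p)) q (u v : tangent q) : dom F (f q) ->
  pullback f alpha u v = \sum_i \sum_j
    u (fun x => crd F i (f x)) * v (fun x => crd F j (f x)) *
    alpha (vec F i (f q)) (vec F j (f q)).
Proof.
move=> Dq; rewrite /pullback.
have E (w : tangent q) : dmap f w = \sum_i w (fun x => crd F i (f x)) *: vec F i (f q).
  rewrite {1}(vec_span F (dmap f w) Dq); apply: eq_bigr => i _.
  by rewrite (dmapE mY)//; exact: crd_smooth.
by rewrite !E two_form_sum2//; case: calpha.
Qed.

(** With f^*alpha = sum_ij A_ij dX_i dX_j, the terms of d(f^*alpha)(U, V, W) that
    contain second derivatives of the X_i cancel against the brackets by
    antisymmetry of A, and the terms that contain derivatives of A combine to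
    d alpha evaluated on coordinate fields, which commute. *)
Lemma closed_pullback : closed_two_form (pullback f alpha).
Proof.
have [Wa ca] := calpha.
have near_dom p (F : frame m (f p)) : \forall q \near p, dom F (f q).
  apply: smooth_map_continuous; apply: open_nbhs_nbhs.
  by split; [exact: frame_open|exact: frame_mem].
have sA p (F : frame m (f p)) i j :
    smooth_at p (fun q => alpha (vec F i (f q)) (vec F j (f q))).
  have [_ _ _ sm] := Wa; apply: (sf (h := fun y => alpha (vec F i y) (vec F j y))).
  by apply: sm; apply: vec_smooth; exact: frame_mem.
have sx p (F : frame m (f p)) i : smooth_at p (fun q => crd F i (f q)).
  by apply: sf; apply: crd_smooth; exact: frame_mem.
have loc p (F : frame m (f p)) (U V : vector_field X) :
    {near p, (fun q => pullback f alpha (U q) (V q)) =1 (fun q => \sum_i \sum_j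
      U q (fun x => crd F i (f x)) * V q (fun x => crd F j (f x)) *
      alpha (vec F i (f q)) (vec F j (f q)))}.
  by apply: filterS (near_dom p F) => q Dq; exact: pullback_frame.
split.
  have [l d s sm] := Wa; split.
  - by move=> p u a v1 v2; rewrite /pullback (dmap_linear mY)// l.
  - by move=> p u; exact: d.
  - by move=> p u v; exact: s.
  - move=> p U V sU sV; have [F _] := frame_exists mY (f p).
    have N := loc p F U V.
    apply: (smooth_near_eq mX (f := fun q => \sum_i \sum_j
      U q (fun x => crd F i (f x)) * V q (fun x => crd F j (f x)) *
      alpha (vec F i (f q)) (vec F j (f q)))).
      by apply: filterS N => q ->.
    apply: (smooth_sum mX) => i; apply: (smooth_sum mX) => j.
    by do 2![apply: (smoothM mX) => //]; [exact: sU|exact: sV].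
move=> p U V W sU sV sW.
have [F _] := frame_exists mY (f p).
set X_ := fun i (q : X) => crd F i (f q) : R^o.
pose A i j q : R^o := alpha (vec F i (f q)) (vec F j (f q)).
pose c i j k : R := vec F i (f p) (fun y => alpha (vec F j y) (vec F k y)).
have Dp : dom F (f p) by exact: frame_mem.
have sXi i : smooth_at p (X_ i) by exact: sx.
have dA (u : tangent p) i j : u (A i j) = \sum_k u (X_ k) * c k i j.
  have sa : smooth_at (f p) (fun y => alpha (vec F i y) (vec F j y)).
    by have [_ _ _ sm] := Wa; apply: sm; exact: vec_smooth.
  rewrite -(dmapE mY u (sf (p:=p)) sa) (vec_span F (dmap f u) Dp) tangent_sumE.
  by apply: eq_bigr => k _; rewrite (dmapE mY)//; exact: crd_smooth.
(* the bracket of two coordinate fields kills the coordinates, hence vanishes *)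
have brk i j : lie_bracket (vec F i) (vec F j) (f p) = 0.
  rewrite (vec_span F (lie_bracket _ _ _) Dp) big1// => k _.
  rewrite (lie_bracketE mY); try by [exact: vec_smooth|exact: crd_smooth].
  have cst i' : {near f p, (fun q => vec F i' q (crd F k)) =1 (fun=> (i' == k)%:R)}.
    apply: filterS (open_nbhs_nbhs (conj (frame_open F) Dp)) => q Dq.
    exact: vec_crd.
  by rewrite !(tangent_near_eq mY _ (cst _)) !(tangent_cst mY) subrr scale0r.
have cyc i j k : c i j k - c j i k + c k i j = 0.
  have := ca (f p) (vec F i) (vec F j) (vec F k) (vec_smooth F i Dp)
    (vec_smooth F j Dp) (vec_smooth F k Dp).
  have z (u : tangent (f p)) : alpha 0 u = 0.
    by rewrite (two_form_antisym Wa) (two_form0 Wa) oppr0.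
  by rewrite /ext_d2 !brk !z !subr0 addr0.
have dT (T B C : vector_field X) : smooth_vf_at p B -> smooth_vf_at p C ->
  T p (fun q => pullback f alpha (B q) (C q)) =
  \sum_i \sum_j (T p (fun q => B q (X_ i)) * C p (X_ j) * A i j p
   + B p (X_ i) * T p (fun q => C q (X_ j)) * A i j p
   + \sum_k T p (X_ k) * B p (X_ i) * C p (X_ j) * c k i j).
  move=> sB sC; rewrite (tangent_near_eq mX _ (loc p F B C)).
  have sBC i j : smooth_at p (fun q => B q (X_ i) * C q (X_ j)).
    by apply: (smoothM mX); [exact: sB|exact: sC].
  have s3 i j : smooth_at p (fun q => B q (X_ i) * C q (X_ j) * A i j q).
    by apply: (smoothM mX) => //; exact: sA.
  rewrite (@tangent_sum _ _ _ mX _ _ _ _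
    (fun i q => \sum_j B q (X_ i) * C q (X_ j) * A i j q)); last first.
    by move=> i; exact: (smooth_sum mX).
  apply: eq_bigr => i _.
  rewrite (@tangent_sum _ _ _ mX _ _ _ _
    (fun j q => B q (X_ i) * C q (X_ j) * A i j q))//.
  apply: eq_bigr => j _; have SA : smooth_at p (A i j) by exact: sA.
  rewrite tangentM// tangentM; try by [exact: sB|exact: sC].
  rewrite dA mulr_sumr mulrDl; congr (_ + _).
  by apply: eq_bigr => k _; ring.
have pb (u v : tangent p) : pullback f alpha u v = \sum_i \sum_j u (X_ i) * v (X_ j) * A i j p.
  exact: pullback_frame.
have As i j : A i j p = - A j i p by exact: (two_form_antisym Wa).
have brE (B C : vector_field X) : smooth_vf_at p B -> smooth_vf_at p C -> forall i,
    lie_bracket B C p (X_ i) = B p (fun q => C q (X_ i)) - C p (fun q => B q (X_ i)).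
  by move=> sB sC i; rewrite (lie_bracketE mX).
(* S collects the terms with second derivatives, T3 those with derivatives of A *)
pose S (b c : 'I_m -> R) := \sum_i \sum_j b i * c j * A i j p.
pose T3 (a b d : 'I_m -> R) := \sum_i \sum_j \sum_k a k * b i * d j * c k i j.
have S_antisym b d : S b d = - S d b.
  rewrite /S exchange_big /= -sumrN; apply: eq_bigr => i _; rewrite -sumrN.
  by apply: eq_bigr => j _; rewrite (As j i); ring.
have S_sub b b' d : S (fun i => b i - b' i) d = S b d - S b' d.
  rewrite /S -sumrB; apply: eq_bigr => i _; rewrite -sumrB.
  by apply: eq_bigr => j _; ring.
have dTS (T B C : vector_field X) : smooth_vf_at p B -> smooth_vf_at p C ->
  T p (fun q => pullback f alpha (B q) (C q)) =
  S (fun i => T p (fun q => B q (X_ i))) (fun i => C p (X_ i))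
  + S (fun i => B p (X_ i)) (fun i => T p (fun q => C q (X_ i)))
  + T3 (fun i => T p (X_ i)) (fun i => B p (X_ i)) (fun i => C p (X_ i)).
  move=> sB sC; rewrite dT// /S /T3 -!big_split /=; apply: eq_bigr => i _.
  by rewrite -!big_split.
have pbS (B C D : vector_field X) : smooth_vf_at p B -> smooth_vf_at p C ->
  pullback f alpha (lie_bracket B C p) (D p) =
  S (fun i => B p (fun q => C q (X_ i))) (fun i => D p (X_ i))
  - S (fun i => C p (fun q => B q (X_ i))) (fun i => D p (X_ i)).
  move=> sB sC; rewrite pb -S_sub; apply: eq_bigr => i _; apply: eq_bigr => j _.
  by rewrite brE.
have rot (g : 'I_m -> 'I_m -> 'I_m -> R) :
    \sum_i \sum_j \sum_k g i j k = \sum_j \sum_k \sum_i g i j k.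
  rewrite exchange_big /=; apply: eq_bigr => j _; exact: exchange_big.
have T3_cyc a b d : T3 a b d - T3 b a d + T3 d a b = 0.
  have E1 : T3 b a d = \sum_i \sum_j \sum_k a k * b i * d j * c i k j.
    rewrite /T3 rot exchange_big /=; apply: eq_bigr => i _; apply: eq_bigr => j _.
    by apply: eq_bigr => k _; ring.
  have E2 : T3 d a b = \sum_i \sum_j \sum_k a k * b i * d j * c j k i.
    rewrite /T3 rot; apply: eq_bigr => i _; apply: eq_bigr => j _.
    by apply: eq_bigr => k _; ring.
  rewrite E1 E2 /T3 -sumrB -big_split big1//= => i _.
  rewrite -sumrB -big_split big1//= => j _.
  rewrite -sumrB -big_split big1//= => k _.
  by rewrite -mulrBr -mulrDr cyc mulr0.
rewrite /ext_d2 !dTS// !pbS//.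
pose u i : R := U p (X_ i); pose v i : R := V p (X_ i); pose w i : R := W p (X_ i).
rewrite -(T3_cyc u v w).
rewrite (S_antisym v (fun i => U p (fun q => W q (X_ i)))).
rewrite (S_antisym u (fun i => V p (fun q => W q (X_ i)))).
rewrite (S_antisym u (fun i => W p (fun q => V q (X_ i)))).
rewrite -/u -/v -/w.
by ring.
Qed.

End Pullback.

(** * Linear algebra *)

Section LinearAlgebra.
Context {K : fieldType}.

Lemma linear_rV_mx n m (f : 'rV[K]_n -> 'rV[K]_m) :
  (forall a u v, f (a *: u + v) = a *: f u + f v) ->
  exists A : 'M[K]_(n, m), forall r, f r = r *m A.
Proof.
move=> lf.
pose fM := GRing.isLinear.Build _ _ _ _ f lf.
pose fL : {linear 'rV[K]_n -> 'rV[K]_m} := HB.pack f fM.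
by exists (lin1_mx fL) => r; rewrite mul_rV_lin1.
Qed.

Lemma onto_row_full n m (A : 'M[K]_(n, m)) :
  (forall y : 'rV[K]_m, exists x : 'rV[K]_n, x *m A = y) -> row_full A.
Proof.
move=> sA; rewrite -sub1mx; apply/row_subP => i.
by have [x <-] := sA (row i 1%:M); exact: submxMl.
Qed.

(** The fibre product of S and T is the kernel of (S, - T), of dimension
    2 N - m; an injective map from a space of that dimension is onto. *)
Lemma fibre_product_onto N m k (P1 P2 : 'M[K]_(k, N)) (S T : 'M[K]_(N, m)) :
  k = (N + N - m)%N -> row_full S -> P1 *m S = P2 *m T ->
  (forall r : 'rV[K]_k, r *m P1 = 0 -> r *m P2 = 0 -> r = 0) ->
  forall u w : 'rV[K]_N, u *m S = w *m T ->
    exists r : 'rV[K]_k, r *m P1 = u /\ r *m P2 = w.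
Proof.
move=> kE fS PST inj u w uw.
pose P := row_mx P1 P2; pose D := col_mx S (- T).
have freeP : row_free P.
  rewrite -kermx_eq0; apply/rowV0P => r /sub_kermxP.
  rewrite mul_mx_row => /eqP; rewrite -row_mx0 => /eqP /eq_row_mx[r1 r2].
  exact: inj.
have rD : \rank D = m.
  apply/anti_leq; rewrite rank_leq_col /=.
  have /eqP {1}<- := fS; apply: mxrankS.
  by rewrite -addsmxE addsmxSl.
have PD : (P <= kermx D)%MS.
  by apply/sub_kermxP; rewrite mul_row_col mulmxN PST subrr.
have eqPD : (P == kermx D)%MS.
  rewrite PD /= -(geq_leqif (mxrank_leqif_sup PD)) mxrank_ker rD.
  by move: freeP; rewrite /row_free => /eqP ->; rewrite kE.
have : (row_mx u w <= P)%MS.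
  rewrite (eqmxP eqPD); apply/sub_kermxP.
  by rewrite mul_row_col mulmxN uw subrr.
move=> /submxP[r]; rewrite mul_mx_row => /eq_row_mx[-> ->].
by exists r.
Qed.

(** The orthogonal of ker T with respect to W is ker S + (ker T /\ ker W): the
    sum is direct and contained in the orthogonal, and both have dimension
    m + dim (ker T /\ ker W).  The component of v in ker S is the required v'. *)
Lemma split_orthogonal m (W : 'M[K]_(2 * m)) (S T : 'M[K]_(2 * m, m)) :
  W^T = - W -> row_full S -> row_full T ->
  (forall v w : 'rV[K]_(2 * m), v *m S = 0 -> w *m T = 0 -> v *m W *m w^T = 0) ->
  (forall v : 'rV[K]_(2 * m), v *m W = 0 -> v *m S = 0 -> v *m T = 0 -> v = 0) ->
  forall v : 'rV[K]_(2 * m),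
  (forall w : 'rV[K]_(2 * m), w *m T = 0 -> v *m W *m w^T = 0) ->
  exists v' : 'rV[K]_(2 * m), [/\ v' *m S = 0, v' *m T = v *m T & v' *m W = v *m W].
Proof.
move=> Wa /eqP fS /eqP fT orth ker v vT.
pose A := kermx S; pose B := kermx T; pose BK := (B :&: kermx W)%MS.
pose O := kermx (W *m B^T).
have rA : \rank A = m by rewrite mxrank_ker fS; lia.
have rB : \rank B = m by rewrite mxrank_ker fT; lia.
have rWB : (\rank (W *m B^T) + \rank BK)%N = m.
  rewrite -mxrank_tr trmx_mul trmxK Wa mulmxN mxrank_opp.
  by rewrite mxrank_mul_ker.
have rO : \rank O = (m + \rank BK)%N by rewrite mxrank_ker; lia.
have inO (x : 'rV[K]_(2 * m)) :
    (forall w : 'rV[K]_(2 * m), w *m T = 0 -> x *m W *m w^T = 0) -> (x <= O)%MS.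
  move=> H; apply/sub_kermxP; rewrite mulmxA.
  apply/row_matrixP => i; rewrite row0.
  apply/rowP => j; rewrite ord1 {i} [RHS]mxE.
  have := H (row j B) _; rewrite -row_mul mulmx_ker row0 => /(_ erefl).
  move=> /matrixP /(_ 0 0); rewrite [RHS]mxE => <-.
  rewrite [LHS]mxE [LHS]mxE [RHS]mxE; apply: eq_bigr => k _.
  by congr (_ * _); rewrite !mxE.
have AO : (A <= O)%MS.
  apply/row_subP => i; apply: inO => w wT; apply: orth => //.
  by rewrite -row_mul mulmx_ker row0.
have BKO : (BK <= O)%MS.
  apply/sub_kermxP; rewrite mulmxA.
  have /sub_kermxP -> : (BK <= kermx W)%MS by exact: capmxSr.
  by rewrite mul0mx.
have cap0 : (A :&: BK)%MS = 0.
  apply/eqP/rowV0P => x; rewrite !sub_capmx.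
  move=> /and3P[/sub_kermxP xS /sub_kermxP xT /sub_kermxP xW].
  exact: ker.
have rAB : \rank (A + BK)%MS = (m + \rank BK)%N.
  by have := mxrank_sum_cap A BK; rewrite cap0 mxrank0 addn0 rA.
have sub : (A + BK <= O)%MS by rewrite addsmx_sub AO.
have Osub : (O <= A + BK)%MS.
  by rewrite -(geq_leqif (mxrank_leqif_sup sub)) rO rAB.
have /sub_addsmxP[[u1 u2] /= vE] := submx_trans (inO v vT) Osub.
exists (u1 *m A).
have BKT : BK *m T = 0 by apply/sub_kermxP; exact: capmxSl.
have BKW : BK *m W = 0 by apply/sub_kermxP; exact: capmxSr.
split; first by rewrite -mulmxA mulmx_ker mulmx0.
- by rewrite vE mulmxDl -[u2 *m BK *m T]mulmxA BKT mulmx0 addr0.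
- by rewrite vE mulmxDl -[u2 *m BK *m W]mulmxA BKW mulmx0 addr0.
Qed.

End LinearAlgebra.

Section Coordinates.
Context {R : realType}.

Lemma tangent_coord n (X : smoothSpace R) (p : X) : is_manifold n X ->
  exists (co : tangent p -> 'rV[R]_n) (ve : 'rV[R]_n -> tangent p),
    [/\ cancel co ve, cancel ve co,
      forall a u v, co (a *: u + v) = a *: co u + co v &
      forall a u v, ve (a *: u + v) = a *: ve u + ve v].
Proof.
move=> mX; have [F _] := frame_exists mX p; have Dp := frame_mem F.
exists (fun v => \row_i v (crd F i)), (fun r => \sum_i r 0 i *: vec F i p); split.
- move=> v; rewrite [RHS](vec_span F v Dp); apply: eq_bigr => i _; by rewrite mxE.
- move=> r; apply/rowP => i; rewrite mxE tangent_sumE (bigD1 i)//= big1 ?addr0.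
    by rewrite vec_crd// eqxx mulr1.
  by move=> j ji; rewrite vec_crd// (negbTE ji) mulr0.
- by move=> a u v; apply/rowP => i; rewrite !mxE.
- move=> a u v; rewrite scaler_sumr -big_split; apply: eq_bigr => i _ /=.
  by rewrite !mxE scalerDl scalerA.
Qed.

End Coordinates.

(** * Subspaces of products *)

Section SubProducts.
Context {R : realType}.
Implicit Types X Y Z : smoothSpace R.

Lemma smooth_fst X Y : smooth_map (fst : prod_space X Y -> X).
Proof.
move=> p h sh; exists 1%N, 0%N, (fun=> h), (fun _ _ => 0), (fun y => y 0 (lshift 0 0)).
split => //=; [by case|exact: Cinfty_at_coord|].
by apply: (@filterE _ _ (@nbhs_filter (X * Y)%type p)) => q; rewrite row_mxEl mxE.
Qed.

Lemma smooth_snd X Y : smooth_map (snd : prod_space X Y -> Y).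
Proof.
move=> p h sh; exists 0%N, 1%N, (fun _ _ => 0), (fun=> h), (fun y => y 0 (rshift 0 0)).
split => //=; [by case|exact: Cinfty_at_coord|].
by apply: (@filterE _ _ (@nbhs_filter (X * Y)%type p)) => q; rewrite row_mxEr mxE.
Qed.

Lemma smooth_set_val X (A : set X) : smooth_map (set_val : sub_space A -> X).
Proof. by move=> p h sh; exists h; split=> //; apply: filterE. Qed.

(** Merges the two families of functions on the factors into one, to which
    [smooth_comp] and [tangent_comp] apply. *)
Lemma smooth_subprodP X Y (A : set (prod_space X Y)) (p : sub_space A)
    (h : sub_space A -> R^o) : smooth_at p h ->
  exists (k : nat) (a : 'I_k -> X * Y -> R^o) (F : 'rV[R]_k -> R^o),
    [/\ forall i, (exists2 b, smooth_at (set_val p).1 b & a i = (fun q => b q.1)) \/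
                  (exists2 b, smooth_at (set_val p).2 b & a i = (fun q => b q.2)),
        Cinfty_at (\row_i a i (set_val p)) F &
        \forall q \near p, h q = F (\row_i a i (set_val q))].
Proof.
move=> [H [[k [l [a [b [F [sa sb sF HF]]]]]] hH]].
pose ab i (q : X * Y) : R^o :=
  match fintype.split i with inl i => a i q.1 | inr j => b j q.2 end.
exists (k + l)%N, ab, F.
have E q : \row_i ab i q = row_mx (\row_i a i q.1) (\row_j b j q.2).
  by apply/rowP => i; rewrite !mxE /ab; case: (fintype.split _) => j; rewrite mxE.
split.
- move=> i; rewrite /ab; case: (fintype.split i) => j; [left|right].
    by exists (a j).
  by exists (b j).
- by rewrite E.
- have cv : continuous (set_val : sub_space A -> prod_space X Y).
    exact: initial_continuous.
  have N : \forall q \near p, H (set_val q) =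
      F (row_mx (\row_i a i (set_val q).1) (\row_j b j (set_val q).2)) := cv p _ HF.
  by apply: filterS2 hH N => q -> ->; rewrite E.
Qed.

Lemma smooth_into_subprod n1 n2 n3 X Y Z (A : set (prod_space X Y))
    (f : Z -> sub_space A) :
  is_manifold n1 X -> is_manifold n2 Y -> is_manifold n3 Z ->
  smooth_map (fun z => (set_val (f z)).1) ->
  smooth_map (fun z => (set_val (f z)).2) -> smooth_map f.
Proof.
move=> mX mY mZ s1 s2 p h /smooth_subprodP[k [a [F [sa sF hF]]]].
have cf : continuous f.
  apply: (@continuous_comp_initial (set_type A) Z (prod_space X Y) set_val f) => z.
  have -> : (set_val \o f) = (fun z => ((set_val (f z)).1, (set_val (f z)).2)).
    by apply/funext => y /=; case: (set_val _).
  by apply: cvg_pair; [exact: (smooth_map_continuous mZ mX s1)|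
                      exact: (smooth_map_continuous mZ mY s2)].
have N : \forall q \near p, h (f q) = F (\row_i a i (set_val (f q))) := cf p _ hF.
apply: (smooth_near_eq mZ (f := fun q => F (\row_i a i (set_val (f q))))).
  by apply: filterS N => q ->.
apply: (smooth_comp mZ (a := fun i q => a i (set_val (f q)))) => // i.
by have [[b sb ->]|[b sb ->]] := sa i; [exact: s1|exact: s2].
Qed.

Lemma tangent_subprod_eq n X Y (A : set (prod_space X Y)) (p : sub_space A)
    (u v : tangent p) :
  is_manifold n (sub_space A) ->
  (forall b, smooth_at (set_val p).1 b ->
     u (fun q => b (set_val q).1) = v (fun q => b (set_val q).1)) ->
  (forall b, smooth_at (set_val p).2 b ->
     u (fun q => b (set_val q).2) = v (fun q => b (set_val q).2)) -> u = v.
Proof.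
move=> mA E1 E2; apply: tangent_eq => h /smooth_subprodP[k [a [F [sa sF hF]]]].
have sa' i : smooth_at p (fun q : sub_space A => a i (set_val q)).
  have [[b sb ->]|[b sb ->]] := sa i.
    by apply: (@smooth_set_val (prod_space X Y) A p (fun q => b q.1)); apply: smooth_fst.
  by apply: (@smooth_set_val (prod_space X Y) A p (fun q => b q.2)); apply: smooth_snd.
have N : {near p, h =1 fun q => F (\row_i a i (set_val q))} by exact: hF.
rewrite !(tangent_near_eq mA _ N).
rewrite !(@tangent_comp _ _ _ mA _ _ _ (fun i q => a i (set_val q)) F)//.
apply: eq_bigr => i _; congr (_ * _).
by have [[b sb ->]|[b sb ->]] := sa i; [exact: E1|exact: E2].
Qed.

End SubProducts.

(** * Vectors tangent to the manifold of composable pairs *)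

Section GroupoidTangents.
Context {R : realType} {m : nat} {M : smoothSpace R}.
Hypothesis mM : is_manifold m M.
Variable G : lieGroupoid m M.

Let mG : is_manifold (gdim G) G := arrowsP G.
Let mC : is_manifold _ (composable_pairs G) := composableP G.

Lemma smooth_pr1 : smooth_map (@pr1 _ _ _ G).
Proof.
move=> c h sh; apply: (@smooth_set_val _ (prod_space G G) _ c (fun q => h q.1)).
exact: smooth_fst.
Qed.

Lemma smooth_pr2 : smooth_map (@pr2 _ _ _ G).
Proof.
move=> c h sh; apply: (@smooth_set_val _ (prod_space G G) _ c (fun q => h q.2)).
exact: smooth_snd.
Qed.

Lemma smooth_mul_map : smooth_map (@mul_map _ _ _ G).
Proof. exact: mul_smooth. Qed.

Lemma smooth_src : smooth_map (@src _ _ _ G).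
Proof. by have [] := src_submersion G. Qed.

Lemma smooth_tgt : smooth_map (@tgt _ _ _ G).
Proof. by have [] := tgt_submersion G. Qed.

Lemma composable_srctgt (c : composable_pairs G) : src (pr1 c) = tgt (pr2 c).
Proof. exact: (set_valP c). Qed.

Definition cpair (g h : G) (gh : src g = tgt h) : composable_pairs G :=
  exist (fun x => x \in _) (g, h) (mem_set gh).

Lemma composable_eq (c d : composable_pairs G) : pr1 c = pr1 d -> pr2 c = pr2 d -> c = d.
Proof.
move=> e1 e2; apply: val_inj.
by rewrite [LHS]surjective_pairing [RHS]surjective_pairing; congr (_, _).
Qed.

Lemma smooth_into_composable n (X : smoothSpace R) (f : X -> composable_pairs G) :
  is_manifold n X -> smooth_map (fun x => pr1 (f x)) ->
  smooth_map (fun x => pr2 (f x)) -> smooth_map f.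
Proof. by move=> mX s1 s2; apply: smooth_into_subprod mG mG mX s1 s2. Qed.

Lemma tangent_composable_eq (c : composable_pairs G) (u v : tangent c) :
  dmap (@pr1 _ _ _ G) u = dmap (@pr1 _ _ _ G) v ->
  dmap (@pr2 _ _ _ G) u = dmap (@pr2 _ _ _ G) v -> u = v.
Proof.
move=> e1 e2; apply: (tangent_subprod_eq mC) => b sb.
  have := congr1 (fun w => tangent_fun w b) e1.
  by rewrite !(dmapE mG _ (@smooth_pr1 c)).
have := congr1 (fun w => tangent_fun w b) e2.
by rewrite !(dmapE mG _ (@smooth_pr2 c)).
Qed.

(** [dmap src u] and [dmap tgt w] are based at points that are only
    propositionally equal; they are compared as derivations.  The components
    determine a tangent vector ([tangent_composable_eq]), so the claim is a
    dimension count. *)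
Lemma tangent_composable_onto (c : composable_pairs G)
    (u : tangent (pr1 c)) (w : tangent (pr2 c)) :
  (forall b, smooth_at (src (pr1 c)) b ->
     dmap (@src _ _ _ G) u b = dmap (@tgt _ _ _ G) w b) ->
  exists z : tangent c, dmap (@pr1 _ _ _ G) z = u /\ dmap (@pr2 _ _ _ G) z = w.
Proof.
move=> uw.
have [co1 [ve1 [coK1 veK1 lco1 lve1]]] := tangent_coord (pr1 c) mG.
have [co2 [ve2 [coK2 veK2 lco2 lve2]]] := tangent_coord (pr2 c) mG.
have [coc [vec [coKc veKc lcoc lvec]]] := tangent_coord c mC.
have [cox [vex [coKx veKx lcox lvex]]] := tangent_coord (src (pr1 c)) mM.
(* the differential of the target, seen at the common base point *)
have [dt dtE] : exists dt : tangent (pr2 c) -> tangent (src (pr1 c)),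
    forall w b, smooth_at (src (pr1 c)) b -> dt w b = w (fun x => b (tgt x)).
  have := composable_srctgt c; move: (src (pr1 c)) => x ->.
  by exists (fun w => dmap (@tgt _ _ _ G) w) => w' b sb; rewrite (dmapE mM _ (@smooth_tgt _)).
have dtl a v1 v2 : dt (a *: v1 + v2) = a *: dt v1 + dt v2.
  by apply: tangent_eq => b sb; rewrite tangent_linE !dtE.
have [S SE] : exists S : 'M[R]_(_, _), forall r,
    cox (dmap (@src _ _ _ G) (ve1 r)) = r *m S.
  apply: linear_rV_mx => a v1 v2.
  by rewrite lve1 (@dmap_linear _ _ _ _ mM _ _ _ _ _ (@smooth_src _)) lcox.
have [T TE] : exists T : 'M[R]_(_, _), forall r, cox (dt (ve2 r)) = r *m T.
  by apply: linear_rV_mx => a v1 v2; rewrite lve2 dtl lcox.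
have [P1 P1E] : exists P : 'M[R]_(_, _), forall r,
    co1 (dmap (@pr1 _ _ _ G) (vec r)) = r *m P.
  apply: linear_rV_mx => a v1 v2.
  by rewrite lvec (@dmap_linear _ _ _ _ mG _ _ _ _ _ (@smooth_pr1 _)) lco1.
have [P2 P2E] : exists P : 'M[R]_(_, _), forall r,
    co2 (dmap (@pr2 _ _ _ G) (vec r)) = r *m P.
  apply: linear_rV_mx => a v1 v2.
  by rewrite lvec (@dmap_linear _ _ _ _ mG _ _ _ _ _ (@smooth_pr2 _)) lco2.
have fS : row_full S.
  apply: onto_row_full => y.
  have [_ /(_ _ (vex y))[v vE]] := src_submersion G.
  by exists (co1 v); rewrite -SE coK1 vE veKx.
have src_pr (z : tangent c) :
    dmap (@src _ _ _ G) (dmap (@pr1 _ _ _ G) z) = dt (dmap (@pr2 _ _ _ G) z).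
  apply: tangent_eq => b sb; rewrite dtE//.
  rewrite (dmapE mM _ (@smooth_src _))// (dmapE mG _ (@smooth_pr1 _)); last exact: smooth_src.
  rewrite (dmapE mG _ (@smooth_pr2 _)); last first.
    by apply: smooth_tgt; rewrite -composable_srctgt.
  by congr (tangent_fun z _); apply/funext => d; rewrite composable_srctgt.
have co0 : co1 0 = 0.
  have := lco1 (-1) 0 0; rewrite scaler0 addr0 scaleN1r addNr; exact.
have co20 : co2 0 = 0.
  have := lco2 (-1) 0 0; rewrite scaler0 addr0 scaleN1r addNr; exact.
have PST : P1 *m S = P2 *m T.
  apply/row_matrixP => i; rewrite !row_mul !rowE -P1E -P2E -SE -TE.
  by rewrite coK1 coK2 src_pr.
have inj (r : 'rV[R]_(gdim G + gdim G - m)) : r *m P1 = 0 -> r *m P2 = 0 -> r = 0.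
  rewrite -P1E -P2E => r1 r2; apply: (can_inj veKc).
  have v0 : vec 0 = 0.
    have := lvec (-1) 0 0; rewrite scaler0 addr0 scaleN1r addNr; exact.
  rewrite v0; apply: tangent_composable_eq; rewrite (dmap0 mG).
  - by apply: (can_inj coK1); rewrite r1 co0.
  - exact: smooth_pr1.
  - by apply: (can_inj coK2); rewrite r2 co20.
  - exact: smooth_pr2.
have uwx : co1 u *m S = co2 w *m T.
  rewrite -SE -TE coK1 coK2; congr (cox _); apply: tangent_eq => b sb.
  rewrite uw// dtE// (dmapE mM _ (@smooth_tgt _))//.
  by rewrite -composable_srctgt.
have [r [r1 r2]] := fibre_product_onto (erefl _) fS PST inj uwx.
exists (vec r); split.
  by apply: (can_inj coK1); rewrite P1E.
by apply: (can_inj coK2); rewrite P2E.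
Qed.

End GroupoidTangents.

(** * Multiplicative 2-forms *)

Section Multiplicative.
Context {R : realType} {m : nat} {M : smoothSpace R}.
Hypothesis mM : is_manifold m M.
Variable G : lieGroupoid m M.
Variable W : two_form G.
Hypotheses (tW : is_two_form W) (mulW : Defs.multiplicative W).

Let mG : is_manifold (gdim G) G := arrowsP G.
Let mC : is_manifold _ (composable_pairs G) := composableP G.

Lemma inv_arrowK (g : G) : inv_arrow (inv_arrow g) = g.
Proof.
rewrite -[LHS]Defs.mulg1 src_inv tgt_inv -Defs.mulVg Defs.mulA ?src_inv ?tgt_inv//.
by rewrite Defs.mulVg src_inv Defs.mul1g.
Qed.

Lemma form_cast (p q : G) (e : p = q) (u v : tangent p) (u' v' : tangent q) :
  (forall h, smooth_at q h -> u h = u' h) ->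
  (forall h, smooth_at q h -> v h = v' h) -> W u v = W u' v'.
Proof.
case: _ / e u' v' => u' v' /tangent_eq -> /tangent_eq -> //.
Qed.

(** A vector v in ker ds is the product of (v, 0) at (g, 1), and a vector w in
    ker dt is the product of some (0, w') at (g, 1), so multiplicativity gives
    W(v, w) = W(v, 0) + W(0, w') = 0.  The first pair is the image of v under
    Theta(k) = (k, 1).  The second one, w' being the product of 0 at g^-1 with
    w, is the image under Psi(k, l) = (k^-1, k l) of the vector (0, w) at
    (g^-1, g): the product of the components of Psi(k, l) is l. *)
Lemma fibres_orthogonal (g : G) (v w : tangent g) :
  dmap (@src _ _ _ G) v = 0 -> dmap (@tgt _ _ _ G) w = 0 -> W v w = 0.
Proof.
move=> dv dw.
pose Theta (k : G) := cpair (esym (tgt_one G (src k))).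
have PsiP (d : composable_pairs G) : src (inv_arrow (pr1 d)) = tgt (mul_map d).
  by rewrite src_inv tgt_mul//; exact: composable_srctgt.
pose Psi d := cpair (PsiP d).
pose c0 := cpair (src_inv g).
have sTheta : smooth_map Theta.
  apply: (smooth_into_composable mG) => [k h //|].
  move=> k h sh; apply: (@smooth_src _ _ _ G k (fun x => h (unit_arrow G x))).
  exact: one_smooth.
have sPsi : smooth_map Psi.
  apply: (smooth_into_composable mC) => d h sh; last exact: smooth_mul_map sh.
  by apply: (@smooth_pr1 _ _ _ G d (fun x => h (inv_arrow x))); exact: inv_smooth.
have [z [z1 z2]] : exists z : tangent c0,
    dmap (@pr1 _ _ _ G) z = 0 /\ dmap (@pr2 _ _ _ G) z = w.
  apply: (tangent_composable_onto mM (c := c0)) => b sb.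
  rewrite (dmap0 mM (@smooth_src _ _ _ G _)).
  by symmetry; exact: (congr1 (fun u => tangent_fun u b) dw).
have mulTheta k : mul_map (Theta k) = k by exact: Defs.mulg1.
have mulPsi d : mul_map (Psi d) = pr2 d.
  have sd := composable_srctgt d.
  rewrite /mul_map [pr1 _]/= [pr2 (Psi _)]/=.
  by rewrite Defs.mulA ?src_inv// Defs.mulVg sd Defs.mul1g.
have e : Psi c0 = Theta g.
  by apply: composable_eq; [exact: inv_arrowK|exact: Defs.mulVg].
have [y [y1 y2]] : exists y : tangent (Theta g),
    (forall h, smooth_at (pr1 (Theta g)) h -> y (fun d => h (pr1 d)) = 0) /\
    (forall h, smooth_at g h -> y (fun d => h (mul_map d)) = w h).
  rewrite -e; exists (dmap Psi z); split=> h sh.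
    rewrite (dmapE mC _ (@sPsi c0)); last exact: smooth_pr1.
    have := congr1 (fun u => tangent_fun u (fun k => h (inv_arrow k))) z1.
    rewrite (dmapE mG _ (@smooth_pr1 _ _ _ G c0))//.
    exact: inv_smooth.
  rewrite (dmapE mC _ (@sPsi c0)); last by apply: smooth_mul_map; rewrite mulPsi.
  rewrite -z2 (dmapE mG _ (@smooth_pr2 _ _ _ G c0))//.
  by congr (tangent_fun z _); apply/funext => d; rewrite mulPsi.
have dy : dmap (@pr1 _ _ _ G) y = 0.
  by apply: tangent_eq => h sh; rewrite (dmapE mG _ (@smooth_pr1 _ _ _ G _)) ?y1.
pose x := dmap Theta v.
have dx : dmap (@pr2 _ _ _ G) x = 0.
  apply: tangent_eq => h sh; rewrite (dmapE mG _ (@smooth_pr2 _ _ _ G _))//.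
  rewrite (dmapE mC _ (@sTheta g)); last exact: smooth_pr2.
  have := congr1 (fun u => tangent_fun u (fun k => h (unit_arrow G k))) dv.
  by rewrite (dmapE mM _ (@smooth_src _ _ _ G g))//; exact: one_smooth.
have := mulW x y; rewrite /pullback dy dx.
rewrite (two_form0 tW) (two_form_antisym tW 0) (two_form0 tW) oppr0 addr0 => <-.
symmetry; apply: (form_cast (mulTheta g)) => h sh.
- have sh' : smooth_at (mul_map (Theta g)) h by rewrite mulTheta.
  rewrite (dmapE mG _ (@smooth_mul_map _ _ _ G _))//.
  rewrite (dmapE mC _ (@sTheta g)); last exact: smooth_mul_map.
  by congr (tangent_fun v _); apply/funext => k; rewrite mulTheta.
- have sh' : smooth_at (mul_map (Theta g)) h by rewrite mulTheta.
  by rewrite (dmapE mG _ (@smooth_mul_map _ _ _ G _))// y2.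
Qed.

Hypothesis dimG : gdim G = (2 * m)%N.
Hypothesis kerW : forall (g : G) (v : tangent g),
  (forall w, W v w = 0) -> dmap (@src _ _ _ G) v = 0 ->
  dmap (@tgt _ _ _ G) v = 0 -> v = 0.

(** Written in coordinates, this is [split_orthogonal] for the matrices of
    W, ds and dt at g. *)
Lemma source_representative (g : G) (v : tangent g) :
  (forall w : tangent g, dmap (@tgt _ _ _ G) w = 0 -> W v w = 0) ->
  exists v' : tangent g, [/\ dmap (@src _ _ _ G) v' = 0,
    dmap (@tgt _ _ _ G) v' = dmap (@tgt _ _ _ G) v & forall w, W v' w = W v w].
Proof.
move=> vw.
have mG' : is_manifold (2 * m) G by rewrite -dimG.
have [co [ve [coK veK lco lve]]] := tangent_coord g mG'.
have [cos [ves [cosK vesK lcos lves]]] := tangent_coord (src g) mM.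
have [cot [vet [cotK vetK lcot lvet]]] := tangent_coord (tgt g) mM.
have co0 : co 0 = 0.
  have := lco (-1) 0 0; rewrite scaler0 addr0 scaleN1r addNr; exact.
have cos0 : cos 0 = 0.
  have := lcos (-1) 0 0; rewrite scaler0 addr0 scaleN1r addNr; exact.
have cot0 : cot 0 = 0.
  have := lcot (-1) 0 0; rewrite scaler0 addr0 scaleN1r addNr; exact.
have [S SE] : exists S : 'M[R]_(_, _), forall r,
    cos (dmap (@src _ _ _ G) (ve r)) = r *m S.
  apply: linear_rV_mx => a v1 v2.
  by rewrite lve (@dmap_linear _ _ _ _ mM _ _ _ _ _ (@smooth_src _ _ _ G _)) lcos.
have [T TE] : exists T : 'M[R]_(_, _), forall r,
    cot (dmap (@tgt _ _ _ G) (ve r)) = r *m T.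
  apply: linear_rV_mx => a v1 v2.
  by rewrite lve (@dmap_linear _ _ _ _ mM _ _ _ _ _ (@smooth_tgt _ _ _ G _)) lcot.
have fS : row_full S.
  apply: onto_row_full => y; have [_ /(_ _ (ves y))[u uE]] := src_submersion G.
  by exists (co u); rewrite -SE coK uE vesK.
have fT : row_full T.
  apply: onto_row_full => y; have [_ /(_ _ (vet y))[u uE]] := tgt_submersion G.
  by exists (co u); rewrite -TE coK uE vetK.
have [B BE] : exists B : 'M[R]_(_, _), forall r,
    \row_j W (ve r) (ve (delta_mx 0 j)) = r *m B.
  apply: linear_rV_mx => a v1 v2; apply/rowP => j; rewrite !mxE lve.
  rewrite (two_form_antisym tW) (is_two_formD _ tW).
  by rewrite (two_form_antisym tW (ve v1)) (two_form_antisym tW (ve v2)); ring.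
have veE r : ve r = \sum_j r 0 j *: ve (delta_mx 0 j).
  pose veM := GRing.isLinear.Build _ _ _ _ ve lve.
  pose veL : {linear 'rV[R]_(2 * m) -> tangent g} := HB.pack ve veM.
  rewrite [in LHS](row_sum_delta r) -[ve]/(veL : _ -> _) linear_sum.
  by apply: eq_bigr => j _; rewrite linearZ.
have WE u r : W (ve u) (ve r) = (u *m B *m r^T) 0 0.
  rewrite (veE r) (two_form_sum _ _ _ _ tW) mxE; apply: eq_bigr => j _.
  by rewrite -BE !mxE mulrC.
have Ba : B^T = - B.
  apply/matrixP => i j; rewrite !mxE.
  have E k l : B k l = W (ve (delta_mx 0 k)) (ve (delta_mx 0 l)).
    have /rowP /(_ l) := BE (delta_mx 0 k).
    by rewrite mxE => ->; rewrite -rowE mxE.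
  by rewrite !E (two_form_antisym tW).
have orth (a b : 'rV[R]_(2 * m)) : a *m S = 0 -> b *m T = 0 -> a *m B *m b^T = 0.
  move=> aS bT; apply/matrixP => i j; rewrite !ord1 -WE [RHS]mxE.
  apply: fibres_orthogonal.
    by apply: (can_inj cosK); rewrite SE aS cos0.
  by apply: (can_inj cotK); rewrite TE bT cot0.
have ker (a : 'rV[R]_(2 * m)) : a *m B = 0 -> a *m S = 0 -> a *m T = 0 -> a = 0.
  move=> aB aS aT; rewrite -(veK a) (_ : ve a = 0) ?co0//; apply: kerW.
  - by move=> u; rewrite -(coK u) WE aB mul0mx mxE.
  - by apply: (can_inj cosK); rewrite SE aS cos0.
  - by apply: (can_inj cotK); rewrite TE aT cot0.
have [r [r1 r2 r3]] : exists r : 'rV[R]_(2 * m),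
    [/\ r *m S = 0, r *m T = co v *m T & r *m B = co v *m B].
  apply: (split_orthogonal Ba fS fT orth ker) => b bT.
  apply/matrixP => i j; rewrite !ord1 -WE [RHS]mxE coK; apply: vw.
  by apply: (can_inj cotK); rewrite TE bT cot0.
exists (ve r); split.
- by apply: (can_inj cosK); rewrite SE r1 cos0.
- by apply: (can_inj cotK); rewrite TE r2 -TE coK.
- by move=> w; rewrite -(coK w) WE r3 -WE coK.
Qed.

End Multiplicative.

(** * The gauge transform of a presymplectic groupoid *)

Section GaugeGroupoid.
Context {R : realType} {m : nat} {M : smoothSpace R}.
Hypothesis mM : is_manifold m M.
Variable alpha : two_form M.
Hypothesis calpha : closed_two_form alpha.
Variable G : presymplecticGroupoid m M.

Local Notation s := (@src _ _ _ (groupoid G)).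
Local Notation t := (@tgt _ _ _ (groupoid G)).

Let mG : is_manifold (gdim G) G := arrowsP G.

Definition gauge_omega : two_form G := fun g u v =>
  @omega _ _ _ G g u v + (pullback t alpha u v - pullback s alpha u v).

Lemma gauge_omega_closed : closed_two_form gauge_omega.
Proof.
have ct := closed_pullback mG mM (@smooth_tgt _ _ _ G) calpha.
have cs := closed_pullback mG mM (@smooth_src _ _ _ G) calpha.
have := closed_two_form_lin mG 1 1 (omega_closed G)
  (closed_two_form_lin mG 1 (-1) ct cs).
congr closed_two_form; apply: functional_extensionality_dep => g.
by apply/funext => u; apply/funext => v; rewrite /gauge_omega !mul1r mulN1r.
Qed.

Lemma pullback_comp n1 n2 (X Y : smoothSpace R) (f : X -> Y) (h : Y -> M) (p : X)
    (u v : tangent p) :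
  is_manifold n1 Y -> is_manifold n2 M -> smooth_map f -> smooth_map h ->
  pullback f (pullback h alpha) u v = pullback (fun x => h (f x)) alpha u v.
Proof.
move=> mY mM' sf sh.
by rewrite /pullback !(dmap_comp mY mM' _ (@sf p) (@sh (f p))).
Qed.

Lemma gauge_omega_mul : Defs.multiplicative gauge_omega.
Proof.
move=> c u v.
have P (f : composable_pairs G -> G) : pullback f gauge_omega u v =
    pullback f (@omega _ _ _ G) u v +
    (pullback f (pullback t alpha) u v - pullback f (pullback s alpha) u v).
  by [].
rewrite !P (omega_mul (p := G)).
have s1 := @smooth_pr1 _ _ _ G; have s2 := @smooth_pr2 _ _ _ G.
have s3 := @smooth_mul_map _ _ _ G.
have s4 := @smooth_src _ _ _ G; have s5 := @smooth_tgt _ _ _ G.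
rewrite !(pullback_comp _ _ mG mM) //.
have -> : (fun x : composable_pairs G => t (mul_map x)) = fun x => t (pr1 x).
  by apply/funext => x; rewrite tgt_mul//; exact: composable_srctgt.
have -> : (fun x : composable_pairs G => s (mul_map x)) = fun x => s (pr2 x).
  by apply/funext => x; rewrite src_mul//; exact: composable_srctgt.
have -> : (fun x : composable_pairs G => s (pr1 x)) = fun x => t (pr2 x).
  by apply/funext => x; exact: composable_srctgt.
by ring.
Qed.

Lemma pullback_ker (f : G -> M) (g : G) (u v : tangent g) :
  smooth_map f -> dmap f u = 0 -> pullback f alpha u v = 0.
Proof.
have [ta _] := calpha.
by move=> sf fu; rewrite /pullback fu (two_form_antisym ta) (two_form0 ta) oppr0.
Qed.

Lemma gauge_omega_ker (g : G) (v : tangent g) :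
  (forall w, gauge_omega v w = 0) -> dmap s v = 0 -> dmap t v = 0 -> v = 0.
Proof.
move=> H sv tv; apply: (omega_ker (p := G)) => // w.
have := H w; rewrite /gauge_omega !pullback_ker ?subr0 ?addr0//.
  exact: smooth_src.
exact: smooth_tgt.
Qed.

Definition gauge_groupoid : presymplecticGroupoid m M :=
  PresymplecticGroupoid (groupoid_dim G) gauge_omega_closed gauge_omega_mul
    gauge_omega_ker.

(** In both inclusions the vector realizing an element of one Dirac structure is
    moved into ker ds, where Omega' - Omega reduces to t^*alpha. *)
Lemma gauge_groupoid_integrates (L : subfamilyTT M) :
  integrates G L -> integrates gauge_groupoid (gauge alpha L).
Proof.
have [ta _] := calpha.
have [tO _] := omega_closed G; have [tO' _] := gauge_omega_closed.
have st := @smooth_tgt _ _ _ G; have ss := @smooth_src _ _ _ G.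
have linear_at0 (p : M) (b : tangent p -> R) : linear (b : tangent p -> R^o) -> b 0 = 0.
  by move=> lb; have := lb (-1) 0 0; rewrite scaler0 addr0 scaleN1r addNr.
move=> GL g; apply/seteqP; split=> [_ [e + <-]|e /=].
  rewrite (GL g) => -[le [v [ve /= Ov]]].
  have vt (w : tangent g) : dmap t w = 0 -> @omega _ _ _ G g v w = 0.
    by move=> tw; rewrite -Ov /= tw linear_at0.
  have [v' [sv' tv' Ov']] := source_representative mM tO (@omega_mul _ _ _ G)
    (groupoid_dim G) (@omega_ker _ _ _ G) vt.
  split => /=.
    by move=> a x y; rewrite !fctE le (is_two_formD _ ta) /GRing.scale /=; ring.
  exists v'; split; first by rewrite tv'.
  rewrite /graph_two_form /=; apply/funext => w.
  rewrite /gauge_omega (pullback_ker _ ss sv') subr0 Ov' -Ov.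
  by rewrite /pullback tv' ve.
move=> [le [v [ve Ov]]]; rewrite /graph_two_form /= in Ov.
have vt (w : tangent g) : dmap t w = 0 -> gauge_omega v w = 0.
  by move=> tw; rewrite -Ov /= tw linear_at0.
have [v' [sv' tv' Ov']] := source_representative mM tO' gauge_omega_mul
  (groupoid_dim G) gauge_omega_ker vt.
exists (e.1, e.2 - alpha e.1); last first.
  by case: e le ve Ov => x b _ _ _ /=; rewrite subrK.
rewrite (GL g); split => /=.
  by move=> a x y; rewrite !fctE le (is_two_formD _ ta) /GRing.scale /=; ring.
exists v'; split; first by rewrite tv'.
rewrite /graph_two_form /=; apply/funext => w.
have := Ov' w; rewrite -Ov /gauge_omega (pullback_ker _ ss sv') subr0 /= => E.
transitivity (e.2 (dmap t w) - alpha e.1 (dmap t w)) => //.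
by rewrite -E /pullback tv' ve addrK.
Qed.

End GaugeGroupoid.

Theorem proposition5p13 (R : realType) (m : nat) (M : smoothSpace R)
    (L : subfamilyTT M) (alpha : two_form M) (C : compactness) :
  is_manifold m M -> is_dirac L -> closed_two_form alpha ->
  (C_type C m L <-> C_type C m (gauge alpha L)) /\
  (strong_C_type C m L <-> strong_C_type C m (gauge alpha L)).
Proof.
move=> mM _ ca.
have cN : closed_two_form (fun p u v => - alpha p u v).
  have := closed_two_form_lin mM (-1) 0 ca ca.
  congr closed_two_form; apply: functional_extensionality_dep => p.
  by apply/funext => u; apply/funext => v; rewrite mul0r addr0 mulN1r.
have gaugeK : gauge (fun p u v => - alpha p u v) (gauge alpha L) = L.
  apply: functional_extensionality_dep => p; apply/seteqP; split=> [_ [_ [e Le <-] <-] /=|e Le].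
    by rewrite addrK; case: e Le.
  exists (e.1, e.2 + alpha p e.1); first by exists e.
  by rewrite /= addrK; case: e Le.
have typ (b : two_form M) (K : subfamilyTT M) : closed_two_form b ->
    (C_type C m K -> C_type C m (gauge b K)) /\
    (strong_C_type C m K -> strong_C_type C m (gauge b K)).
  move=> cb; split=> [[G [GK sG CG]]|[G [[GK sG] CG]]];
    exists (gauge_groupoid mM cb G); split => //.
    exact: gauge_groupoid_integrates.
  by split => //; exact: gauge_groupoid_integrates.
have [f1 f2] := typ alpha L ca.
have [g1 g2] := typ _ (gauge alpha L) cN; rewrite gaugeK in g1 g2.
by split; split.
Qed.
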